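(* Let $\mathcal{M}=(S,A,AP,L,I)$ be an interval Markov decision process and let $s,t\in S$ with $s\sim_{(\exists\sigma\forall)} t$. Then for every PCTL state formula $\varphi$ we have $s\models_{(\exists\sigma\forall)}\varphi$ if and only if $t\models_{(\exists\sigma\forall)}\varphi$.
   Context: An interval MDP (IMDP) is a tuple $(S,A,AP,L,I)$ with $S$ a finite set of states, $A$ a finite set of actions, $AP$ a finite set of atomic propositions, $L:S\to 2^{AP}$ a labelling, and $I:S\times A\times S\to\mathbb{I}$ where $\mathbb{I}$ is a set of subintervals of $[0,1]$. For $s\in S,a\in A$, write $s\xrightarrow{a}\mu$ if $\mu$ is a probability distribution on $S$ with $\mu(s')\in I(s,a,s')$ for all $s'$; the set $\Gamma_{s,a}=\{\mu\mid s\xrightarrow{a}\mu\}$ is required to be non-empty. A scheduler is a function $\sigma$ from finite paths to distributions over $A$; a nature is a function $\pi$ mapping a finite path $\omega$ and action $a$ to an element of $\Gamma_{\mathrm{last}(\omega),a}$, where $\mathrm{last}(\omega)$ is the last state of $\omega$. $\Sigma,\Pi$ denote the sets of all schedulers and natures. $\Pr^{\sigma,\pi}_s$ is the unique probability measure on infinite paths (cylinder $\sigma$-algebra) with the one-state cylinder of $s'$ having probability $1$ iff $s'=s$ (else $0$), and $\Pr^{\sigma,\pi}_s[\mathrm{Cyl}(\omega s')]=\Pr^{\sigma,\pi}_s[\mathrm{Cyl}(\omega)]\cdot\sum_{a}\sigma(\omega)(a)\pi(\omega,a)(s')$. PCTL: state formulas $\varphi::=\mathit{true}\mid x\mid\neg\varphi\mid\varphi_1\wedge\varphi_2\mid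 \mathsf{P}_{\bowtie p}(\psi)$, path formulas $\psi::=\mathsf{X}\varphi\mid\varphi_1\mathsf{U}\varphi_2\mid\varphi_1\mathsf{U}^{\le k}\varphi_2$ ($x\in AP$, rational $p\in[0,1]$, $\bowtie\in\{\le,<,\ge,>\}$, $k\in\mathbb{N}$). The relation $\models_{(\exists\sigma\forall)}$: $s\models x$ iff $x\in L(s)$; negation, conjunction as usual; $s\models_{(\exists\sigma\forall)}\mathsf{P}_{\bowtie p}(\psi)$ iff there exists $\sigma\in\Sigma$ such that for all $\pi\in\Pi$, $\Pr^{\sigma,\pi}_s[\{\omega\mid\omega\models_{(\exists\sigma\forall)}\psi\}]\bowtie p$. For $\omega=s_1s_2\cdots$: $\omega\models\mathsf{X}\varphi$ iff $s_2\models\varphi$; $\omega\models\varphi_1\mathsf{U}^{\le k}\varphi_2$ iff some $i\le k$ has $s_i\models\varphi_2$ and $s_j\models\varphi_1$ for all $j<i$; $\omega\models\varphi_1\mathsf{U}\varphi_2$ iff $\omega\models\varphi_1\mathsf{U}^{\le k}\varphi_2$ for some $k$. For $\rho\in\mathrm{Dist}(A)$ write $s\xrightarrow{\rho}\mu$ if there are $\mu_a\in\Gamma_{s,a}$ ($a\in A$) with $\mu=\sum_a\rho(a)\mu_a$. An equivalence relation $R\subseteq S\times S$ is a probabilistic $(\exists\sigma\forall)$-bisimulation if for all $(s,t)\in R$: $L(s)=L(t)$, and for each $\rho_s\in\mathrm{Dist}(A)$ there is $\rho_t\in\mathrm{Dist}(A)$ such that for each $t\xrightarrow{\rho_t}\nu$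 there is $s\xrightarrow{\rho_s}\mu$ with $\mu(C)=\nu(C)$ for every equivalence class $C$ of $R$. $s\sim_{(\exists\sigma\forall)}t$ iff some such bisimulation contains $(s,t)$. *)

(* Defs.v *)
From HB Require Import structures.
From mathcomp Require Import all_boot all_order all_algebra.
From mathcomp Require Import all_classical all_reals all_analysis.

Set Implicit Arguments.
Unset Strict Implicit.
Unset Printing Implicit Defensive.

Import Order.TTheory GRing.Theory Num.Theory.
Local Open Scope ring_scope.
Local Open Scope classical_set_scope.

(* Infinite paths starting (morally) from a state s: the type nat -> S, *)
(* tagged by s only to equip it with a point (needed by MathComp-       *)
(* Analysis to build the generated sigma-algebra).                      *)
Definition ipath (S : finType) (s : S) := nat -> S.
HB.instance Definition _ (S : finType) (s : S) :=
  Choice.copy (ipath s) (nat -> S).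
HB.instance Definition _ (S : finType) (s : S) :=
  isPointed.Build (ipath s) (fun _ => s).

Section IMDP.
Variables (R : realType) (S A AP : finType).

Definition is_dist (T : finType) (f : T -> R) : Prop :=
  (forall x, 0 <= f x) /\ \sum_(x : T) f x = 1.

Implicit Types (I : S -> A -> S -> interval R).

Definition Gamma I (s : S) (a : A) (mu : S -> R) : Prop :=
  is_dist mu /\ forall s', mu s' \in I s a s'.

Definition imdp_wf I : Prop :=
  (forall s a s', {subset I s a s' <= `[0, 1]}) /\
  (forall s a, exists mu, Gamma I s a mu).

(* finite (non-empty) paths: first state and the remaining states *)
Definition fpath := (S * seq S)%type.
Definition fp_last (w : fpath) : S := last w.1 w.2.
Definition fp_states (w : fpath) : seq S := w.1 :: w.2.
Definition fp_ext (w : fpath) (s' : S) : fpath := (w.1, rcons w.2 s').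

Definition scheduler (sigma : fpath -> A -> R) : Prop :=
  forall w, is_dist (sigma w).

Definition nature I (pi : fpath -> A -> S -> R) : Prop :=
  forall w a, Gamma I (fp_last w) a (pi w a).

Definition cyl (s0 : S) (w : fpath) : set (ipath s0) :=
  [set om | forall i, (i < size (fp_states w))%N ->
                      om i = nth w.1 (fp_states w) i].

Definition cylinders (s0 : S) : set (set (ipath s0)) :=
  [set C | exists w, C = @cyl s0 w].

Definition paths (s0 : S) := g_sigma_algebraType (@cylinders s0).

Definition is_Pr (sigma : fpath -> A -> R) (pi : fpath -> A -> S -> R)
    (s : S) (P : probability (paths s) R) : Prop :=
  (forall s', P (@cyl s (s', [::])) = (if s' == s then 1 else 0)%:E) /\
  (forall w s', P (@cyl s (fp_ext w s')) =
      (P (@cyl s w) * (\sum_(a : A) sigma w a * pi w a s')%:E)%E).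

Inductive cmp := CLe | CLt | CGe | CGt.

Definition cmp_sem (c : cmp) (x y : \bar R) : Prop :=
  match c with
  | CLe => (x <= y)%E
  | CLt => (x < y)%E
  | CGe => (x >= y)%E
  | CGt => (x > y)%E
  end.

Inductive sform :=
  | STrue
  | SAtom of AP
  | SNot of sform
  | SAnd of sform & sform
  | SProb of cmp & rat & pform
with pform :=
  | PNext of sform
  | PUntil of sform & sform
  | PBUntil of sform & sform & nat.

Fixpoint wf_sform (phi : sform) : Prop :=
  match phi with
  | STrue | SAtom _ => True
  | SNot phi1 => wf_sform phi1
  | SAnd phi1 phi2 => wf_sform phi1 /\ wf_sform phi2
  | SProb _ p psi => (0 <= p <= 1)%R /\ wf_pform psi
  end
with wf_pform (psi : pform) : Prop :=
  match psi with
  | PNext phi => wf_sform phi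
  | PUntil phi1 phi2 => wf_sform phi1 /\ wf_sform phi2
  | PBUntil phi1 phi2 _ => wf_sform phi1 /\ wf_sform phi2
  end.

Fixpoint sat (L : S -> {set AP}) I (phi : sform) (s : S) : Prop :=
  match phi with
  | STrue => True
  | SAtom x => x \in L s
  | SNot phi1 => ~ sat L I phi1 s
  | SAnd phi1 phi2 => sat L I phi1 s /\ sat L I phi2 s
  | SProb c p psi =>
      exists sigma, scheduler sigma /\
        forall pi, nature I pi ->
          forall P : probability (paths s) R, is_Pr sigma pi P ->
            cmp_sem c (P [set om : paths s | psat L I psi om]) (ratr p)%:E
  end
(* paths om = s_1 s_2 ... are 0-indexed: s_i = om (i - 1) *)
with psat (L : S -> {set AP}) I (psi : pform) (om : nat -> S) : Prop :=
  match psi with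
  | PNext phi => sat L I phi (om 1%N)
  | PBUntil phi1 phi2 k =>
      exists i, (i < k)%N /\ sat L I phi2 (om i) /\
                forall j, (j < i)%N -> sat L I phi1 (om j)
  | PUntil phi1 phi2 =>
      exists k i, (i < k)%N /\ sat L I phi2 (om i) /\
                forall j, (j < i)%N -> sat L I phi1 (om j)
  end.

Definition trans I (s : S) (rho : A -> R) (mu : S -> R) : Prop :=
  exists mus : A -> S -> R,
    (forall a, Gamma I s a (mus a)) /\
    forall s', mu s' = \sum_(a : A) rho a * mus a s'.

Definition bisimulation (L : S -> {set AP}) I (Rl : rel S) : Prop :=
  (forall x, Rl x x) /\ (forall x y, Rl x y -> Rl y x) /\
  (forall x y z, Rl x y -> Rl y z -> Rl x z) /\
  forall s t, Rl s t ->
    L s = L t /\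
    forall rho_s, is_dist rho_s ->
      exists rho_t, is_dist rho_t /\
        forall nu, trans I t rho_t nu ->
          exists mu, trans I s rho_s mu /\
            (* mu(C) = nu(C) for every equivalence class C = [c] *)
            forall c : S, \sum_(x | Rl c x) mu x = \sum_(x | Rl c x) nu x.

Definition bisimilar (L : S -> {set AP}) I (s t : S) : Prop :=
  exists Rl : rel S, bisimulation L I Rl /\ Rl s t.

End IMDP.

(* Main.v *)
Require Import Defs.
From HB Require Import structures.
From mathcomp Require Import all_boot all_order all_algebra.
From mathcomp Require Import all_classical all_reals all_analysis.
From mathcomp Require Import lra.

(** The three kinds of path formulas are reachability objectives read along a
    finite clock, so a probabilistic formula is a game between the scheduler,
    who picks a distribution on actions, and nature, who answers every action.
    A matching scheduler cannot be transported along a path, since the belief on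
    the matched state depends on the still unknown choice of nature; instead the
    set of winning states is characterized by class-invariant data.  The value
    [Val] of the game is the supremum of the class-invariant functions that can
    be kept from decreasing in one discounted step; discounting makes positional
    play optimal (there are finitely many choices of actions), and bisimilar
    states have the same one-step power.  This settles the comparisons [>=] and
    [<=].  Since the intervals need not be closed, nature may be unable to attain
    the value, so [>] and [<] also need the states where the scheduler beats the
    value strictly: a least fixpoint ([BS]) when the scheduler wants to reach the
    goal, and a least fixpoint over sets where nature cannot make progress
    ([BN]) when it wants to avoid it.  Probability measures with prescribed
    transition probabilities exist as images of the Lebesgue measure on [0, 1[
    under a digit expansion. *)

Set Implicit Arguments.
Unset Strict Implicit.
Unset Printing Implicit Defensive.

Import Order.TTheory GRing.Theory Num.Theory.
Import numFieldNormedType.Exports.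
Local Open Scope ring_scope.
Local Open Scope classical_set_scope.

(** * Uniform bounds over finite index types *)

Lemma fin_uniform_nat (T : finType) (P : T -> nat -> Prop) :
  (forall i m n, (m <= n)%N -> P i m -> P i n) ->
  (forall i, exists n, P i n) -> exists n, forall i, P i n.
Proof.
move=> Pm /choice[f Pf]; exists (\max_i f i) => i.
by apply: Pm (Pf i); exact: leq_bigmax.
Qed.

Lemma le_of_eps (R : realType) (x y : R) : (forall e, 0 < e -> x <= y + e) -> x <= y.
Proof. by move=> h; apply/ler_addgt0Pr => e /h. Qed.

Lemma pow_small (R : realType) (l e : R) : 0 <= l < 1 -> 0 < e -> exists n, l ^+ n < e.
Proof.
move=> /andP[l0 l1] e0.
have /cvgrPdist_lt /(_ e e0) : (fun n => l ^+ n) @ \oo --> (0 : R).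
  by apply: cvg_expr; rewrite ger0_norm.
case=> n _ /(_ n (leqnn _)); rewrite sub0r normrN ger0_norm ?exprn_ge0// => h.
by exists n.
Qed.

Lemma fin_uniform_pos (R : realType) (T : finType) (P : T -> R -> Prop) :
  (forall i e e', e' <= e -> P i e -> P i e') ->
  (forall i, exists e, 0 < e /\ P i e) -> exists e, 0 < e /\ forall i, P i e.
Proof.
move=> Pm h.
have [n Hn] : exists n, forall i, P i (2^-1 ^+ n).
  apply: fin_uniform_nat => [i m n mn|i].
    apply: Pm; apply: ler_wiXn2l => //; lra.
  have [e [e0 Pe]] := h i.
  have [|n ne] := @pow_small R 2^-1 e _ e0; first lra.
  by exists n; apply: Pm Pe; exact: ltW.
by exists (2^-1 ^+ n); split=> //; rewrite exprn_gt0.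
Qed.

(** By contraposition: if every index failed at some tolerance, finiteness would give one tolerance
    at which all of them fail. This turns choices that are good up to an arbitrary e into one choice
    that is good for all e at once. *)
Lemma fin_limit_choice (R : realType) (T : finType) (P : T -> R -> Prop) :
  (forall i e e', e <= e' -> P i e -> P i e') ->
  (forall e, 0 < e -> exists i, P i e) -> exists i, forall e, 0 < e -> P i e.
Proof.
move=> Pm h; apply: contrapT => /forallNP H.
have [e [e0 He]] : exists e, 0 < e /\ forall i, ~ P i e.
  apply: fin_uniform_pos => [i e e' ee' n p|i]; first by apply: n; exact: Pm p.
  by have /existsNP[e /not_implyP[e0 ne]] := H i; exists e.
by have [i /He] := h e e0.
Qed.

(** * Expectations over a finite state space *)

Section Dot.
Variables (R : realType) (S : finType).
Implicit Types (mu f g : S -> R).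

Definition dot mu f : R := \sum_s mu s * f s.

Lemma dot_le mu f g : (forall s, 0 <= mu s) ->
  (forall s, 0 < mu s -> f s <= g s) -> dot mu f <= dot mu g.
Proof.
move=> m0 fg; apply: ler_sum => s _.
have := m0 s; rewrite le_eqVlt => /predU1P[<-|ms]; first by rewrite !mul0r.
by rewrite ler_wpM2l ?fg// ltW.
Qed.

Lemma dot_lt mu f g s0 : (forall s, 0 <= mu s) ->
  (forall s, 0 < mu s -> f s <= g s) -> 0 < mu s0 -> f s0 < g s0 ->
  dot mu f < dot mu g.
Proof.
move=> m0 fg ms0 lt0; rewrite /dot (bigD1 s0)//= [ltRHS](bigD1 s0)//=.
apply: ltr_leD; first by rewrite ltr_pM2l.
apply: ler_sum => s _.
have := m0 s; rewrite le_eqVlt => /predU1P[<-|ms]; first by rewrite !mul0r.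
by rewrite ler_wpM2l ?fg// ltW.
Qed.

Lemma dot_cst mu (c : R) : is_dist mu -> dot mu (fun=> c) = c.
Proof. by case=> _ m1; rewrite /dot -mulr_suml m1 mul1r. Qed.

Lemma dotD mu f g : dot mu (fun s => f s + g s) = dot mu f + dot mu g.
Proof. by rewrite /dot -big_split/=; apply: eq_bigr => s _; rewrite mulrDr. Qed.

Lemma dotB mu f g : dot mu (fun s => f s - g s) = dot mu f - dot mu g.
Proof. by rewrite /dot -sumrB; apply: eq_bigr => s _; rewrite mulrBr. Qed.

Lemma dotDc mu f c : is_dist mu -> dot mu (fun s => f s + c) = dot mu f + c.
Proof. by move=> md; rewrite dotD dot_cst. Qed.

Lemma dot_ge0 mu f : is_dist mu -> (forall s, 0 <= f s) -> 0 <= dot mu f.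
Proof. by move=> [m0 _] f0; apply: sumr_ge0 => s _; rewrite mulr_ge0. Qed.

Lemma dot_lec mu f c : is_dist mu -> (forall s, f s <= c) -> dot mu f <= c.
Proof. by move=> md fc; rewrite -(dot_cst c md); apply: dot_le => //; case: md. Qed.

Lemma dist_ex_pos mu : is_dist mu -> exists s, 0 < mu s.
Proof.
move=> [m0 m1]; apply: contrapT => /forallNP h.
suff : \sum_s mu s = 0 by rewrite m1 => /eqP; rewrite oner_eq0.
apply: big1 => s _; apply/eqP; rewrite eq_le m0 andbT leNgt.
exact/negP/h.
Qed.

End Dot.

(** * Clocked reachability under a history-dependent kernel *)

Section Reach.
Variables (R : realType) (S Q : finType).
Variables (nx : Q -> Q) (G D : Q -> S -> bool).
Implicit Types (K : seq S -> S -> R) (q : Q) (s : S).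

Definition stochastic K := forall u, is_dist (K u).

(** Histories list the states visited after the initial one, so prefixing [s'] gives the residual
    object once the first move has led to [s']. *)
Definition after (T : Type) (f : seq S -> T) (s' : S) : seq S -> T :=
  fun u => f (s' :: u).

Definition live q s := ~~ G q s && D q s.

(** [G] is the goal and [D] the constraint on the states visited before it; both read the clock [q],
    so that they may depend on time. *)
Fixpoint reach n q s K : R :=
  if G q s then 1 else if D q s then
    if n is n'.+1
    then dot (K [::]) (fun s' => reach n' (nx q) s' (after K s')) else 0
  else 0.

Fixpoint clk q (u : seq S) : Q := if u is _ :: u' then clk (nx q) u' else q.

Lemma stochastic_after K s' : stochastic K -> stochastic (after K s').
Proof. by move=> h u; exact: h. Qed.

Lemma reach_G n q s K : G q s -> reach n q s K = 1.
Proof. by case: n => [|n]/= ->. Qed.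

Lemma reach_dead n q s K : ~~ G q s -> ~~ D q s -> reach n q s K = 0.
Proof. by case: n => [|n] /= /negbTE -> /negbTE ->. Qed.

Lemma reach_live n q s K : live q s ->
  reach n.+1 q s K = dot (K [::]) (fun s' => reach n (nx q) s' (after K s')).
Proof. by case/andP=> /negbTE/= -> ->. Qed.

Lemma reach0 q s K : live q s -> reach 0 q s K = 0.
Proof. by case/andP=> /negbTE/= -> ->. Qed.

Variant status_spec q s : Prop :=
| StatusG of G q s
| StatusDead of ~~ G q s & ~~ D q s
| StatusLive of live q s.

Lemma statusP q s : status_spec q s.
Proof.
have [Gq|nG] := boolP (G q s); first exact: StatusG.
have [Dq|nD] := boolP (D q s); last exact: StatusDead.
by apply: StatusLive; rewrite /live nG.
Qed.

Lemma reach_ge0 n q s K : stochastic K -> 0 <= reach n q s K.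
Proof.
elim: n q s K => [|n IH] q s K kK.
  by case: (statusP q s) => [h|h h'|h]; [rewrite reach_G|rewrite reach_dead|rewrite reach0].
case: (statusP q s) => [h|h h'|lq];
  [by rewrite reach_G|by rewrite reach_dead|rewrite reach_live//].
by apply: dot_ge0 => // s'; apply: IH; exact: stochastic_after.
Qed.

Lemma reach_le1 n q s K : stochastic K -> reach n q s K <= 1.
Proof.
elim: n q s K => [|n IH] q s K kK.
  by case: (statusP q s) => [h|h h'|h]; [rewrite reach_G|rewrite reach_dead|rewrite reach0].
case: (statusP q s) => [h|h h'|lq];
  [by rewrite reach_G|by rewrite reach_dead|rewrite reach_live//].
by apply: dot_lec => // s'; apply: IH; exact: stochastic_after.
Qed.

Lemma reach_leS n q s K : stochastic K -> reach n q s K <= reach n.+1 q s K.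
Proof.
elim: n q s K => [|n IH] q s K kK; case: (statusP q s) => [h|h h'|lq].
- by rewrite !reach_G.
- by rewrite !reach_dead.
- by rewrite reach0// reach_ge0.
- by rewrite !reach_G.
- by rewrite !reach_dead.
rewrite reach_live// [leRHS]reach_live//.
apply: dot_le => [|s' _]; first by case: (kK [::]).
by apply: IH; exact: stochastic_after.
Qed.

Lemma reach_nondecreasing q s K : stochastic K ->
  nondecreasing_seq (fun n => reach n q s K).
Proof. by move=> kK; apply/nondecreasing_seqP => n; exact: reach_leS. Qed.

Definition Reach q s K : R := sup (range (fun n => reach n q s K)).

Lemma reach_has_ubound q s K : stochastic K ->
  has_ubound (range (fun n => reach n q s K)).
Proof. by move=> kK; exists 1 => _ [n _ <-]; exact: reach_le1. Qed.

Lemma reach_cvg q s K : stochastic K -> reach n q s K @[n --> \oo] --> Reach q s K.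
Proof.
move=> kK; apply: nondecreasing_cvgn; first exact: reach_nondecreasing.
exact: reach_has_ubound.
Qed.

Lemma Reach_ge n q s K : stochastic K -> reach n q s K <= Reach q s K.
Proof. by move=> kK; apply: ub_le_sup; [exact: reach_has_ubound|exists n]. Qed.

Lemma Reach_le c q s K : (forall n, reach n q s K <= c) -> Reach q s K <= c.
Proof.
by move=> h; apply: ge_sup => [|_ [n _ <-]//]; exists (reach 0 q s K), 0%N.
Qed.

Lemma Reach_ge0 q s K : stochastic K -> 0 <= Reach q s K.
Proof. by move=> kK; apply: le_trans (Reach_ge 0 q s kK); exact: reach_ge0. Qed.

Lemma Reach_le1 q s K : stochastic K -> Reach q s K <= 1.
Proof. by move=> kK; apply: Reach_le => n; exact: reach_le1. Qed.

Lemma Reach_G q s K : stochastic K -> G q s -> Reach q s K = 1.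
Proof.
move=> kK Gq; apply/eqP; rewrite eq_le Reach_le1//=.
by rewrite -(reach_G 0 K Gq) Reach_ge.
Qed.

(** The one-step equation of [reach] passes to the limit because the expectation is a finite sum. *)
Lemma Reach_step q s K : stochastic K -> live q s ->
  Reach q s K = dot (K [::]) (fun s' => Reach (nx q) s' (after K s')).
Proof.
move=> kK lq.
have h1 : reach n.+1 q s K @[n --> \oo] --> Reach q s K.
  by rewrite (cvg_shiftS (fun n => reach n q s K)); exact: reach_cvg.
have h2 : reach n.+1 q s K @[n --> \oo] -->
    dot (K [::]) (fun s' => Reach (nx q) s' (after K s')).
  under eq_cvg do rewrite reach_live//.
  rewrite /dot; apply: cvg_big => [|s' _]; first exact: add_continuous.
  apply: cvgMl_tmp.
  by apply: reach_cvg; exact: stochastic_after.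
exact: cvg_unique h1 h2.
Qed.

(* Discounted sub-invariance rules out stalling: v - l^n bounds the n-step
   probability because reach is nonnegative once l^n exceeds the next value. *)
Lemma reach_lower (v : Q -> S -> R) (l : R) n q s K : 0 <= l < 1 ->
  stochastic K -> (forall q s, v q s <= 1) ->
  (forall q s, ~~ G q s -> ~~ D q s -> v q s <= 0) ->
  (forall u, live (clk q u) (last s u) ->
     v (clk q u) (last s u) <= l * dot (K u) (v (nx (clk q u)))) ->
  v q s - l ^+ n <= reach n q s K.
Proof.
move=> /andP[l0 l1] + v1 vd; elim: n q s K => [|n IH] q s K kK h.
  apply: le_trans (reach_ge0 0 q s kK).
  by rewrite expr0 subr_le0.
have ln0 : 0 <= l ^+ n by rewrite exprn_ge0.
have lS0 : 0 <= l ^+ n.+1 by rewrite exprn_ge0.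
case: (statusP q s) => [Gq|nG nD|lq].
- by rewrite reach_G// lerBlDr (le_trans (v1 _ _))// lerDl.
- by rewrite reach_dead// subr_le0 (le_trans (vd _ _ nG nD)).
have H := h [::] lq; rewrite /= in H.
have [m|m] := leP (dot (K [::]) (v (nx q))) (l ^+ n).
  apply: le_trans (reach_ge0 n.+1 q s kK).
  by rewrite subr_le0 (le_trans H)// exprS ler_wpM2l.
rewrite reach_live//.
apply: (@le_trans _ _ (dot (K [::]) (fun s' => v (nx q) s' + - l ^+ n))).
  rewrite dotDc// exprS; nra.
apply: dot_le => [|s' _]; first by case: (kK [::]).
apply: IH => [|u]; first exact: stochastic_after.
exact: (h (s' :: u)).
Qed.

Lemma Reach_lower (v : Q -> S -> R) (l : R) q s K : 0 <= l < 1 ->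
  stochastic K -> (forall q s, v q s <= 1) ->
  (forall q s, ~~ G q s -> ~~ D q s -> v q s <= 0) ->
  (forall u, live (clk q u) (last s u) ->
     v (clk q u) (last s u) <= l * dot (K u) (v (nx (clk q u)))) ->
  v q s <= Reach q s K.
Proof.
move=> l01 kK v1 vd h; apply: le_of_eps => e e0.
have [n ne] := pow_small l01 e0.
have := reach_lower n l01 kK v1 vd h; have := Reach_ge n q s kK; lra.
Qed.

(** The errors e / 2 ^+ k.+1 allowed at histories of length k sum to at most e along any path: the
    first step spends e / 2 and the residual kernel inherits the other half. *)
Lemma reach_upper (v : Q -> S -> R) (e : R) n q s K : 0 <= e ->
  stochastic K -> (forall q s, 0 <= v q s) -> (forall q s, G q s -> v q s = 1) ->
  (forall u, live (clk q u) (last s u) ->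
     dot (K u) (v (nx (clk q u))) <=
       v (clk q u) (last s u) + e / 2 ^+ (size u).+1) ->
  reach n q s K <= v q s + e.
Proof.
move=> + + v0 vG; elim: n q s K e => [|n IH] q s K e e0 kK h;
  case: (statusP q s) => [Gq|nG nD|lq].
- by rewrite reach_G// vG// lerDl.
- by rewrite reach_dead// addr_ge0.
- by rewrite reach0// addr_ge0.
- by rewrite reach_G// vG// lerDl.
- by rewrite reach_dead// addr_ge0.
have H := h [::] lq; rewrite /= expr1 in H.
rewrite reach_live//.
apply: (@le_trans _ _ (dot (K [::]) (fun s' => v (nx q) s' + e / 2))); last first.
  by rewrite dotDc//; lra.
apply: dot_le => [|s' _]; first by case: (kK [::]).
apply: IH => [||u lu]; [by rewrite divr_ge0|exact: stochastic_after|].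
have := h (s' :: u) lu.
by rewrite /= -mulrA -invfM -exprS.
Qed.

Lemma Reach_upper (v : Q -> S -> R) (e : R) q s K : 0 <= e ->
  stochastic K -> (forall q s, 0 <= v q s) -> (forall q s, G q s -> v q s = 1) ->
  (forall u, live (clk q u) (last s u) ->
     dot (K u) (v (nx (clk q u))) <=
       v (clk q u) (last s u) + e / 2 ^+ (size u).+1) ->
  Reach q s K <= v q s + e.
Proof. by move=> *; apply: Reach_le => n; exact: reach_upper. Qed.

End Reach.

(** * The discounted value of an abstract one-step game *)

Section Value.
Variables (R : realType) (S Q : finType).
Variables (nx : Q -> Q) (G D : Q -> S -> bool) (Rl : rel S).
(** [can s T] stands for the power to bring about, from [s], a next-state distribution satisfying
    [T]. It is instantiated by [canS] for the scheduler and by [canN] for nature. *)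
Variable can : S -> ((S -> R) -> Prop) -> Prop.

Definition respects (T : Type) (f : S -> T) := forall s t, Rl s t -> f s = f t.

Hypothesis Rl_refl : forall s, Rl s s.
Hypothesis Rl_sym : forall s t, Rl s t -> Rl t s.
Hypothesis Rl_trans : forall s t u, Rl s t -> Rl t u -> Rl s u.
Hypothesis G_inv : forall q, respects (G q).
Hypothesis D_inv : forall q, respects (D q).
Hypothesis can_sub : forall s (T T' : (S -> R) -> Prop),
  (forall mu, is_dist mu -> T mu -> T' mu) -> can s T -> can s T'.
Hypothesis can_ex : forall s T, can s T -> exists mu, is_dist mu /\ T mu.
Hypothesis can_true : forall s, can s (fun=> True).
Hypothesis can_inv : forall s t (f : S -> R) c, Rl s t -> respects f ->
  can s (fun mu => c <= dot mu f) -> can t (fun mu => c <= dot mu f).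

Local Notation live := (live G D).

(** The discount [l] is part of the witness. With l = 1 a positive value could be preserved forever
    without the goal being reached; the supremum over all l < 1 still gives the undiscounted
    value. *)
Record postfix (l : R) (v : Q -> S -> R) : Prop := Postfix {
  post_l : 0 <= l < 1;
  post_inv : forall q, respects (v q);
  post_ge0 : forall q s, 0 <= v q s;
  post_le1 : forall q s, v q s <= 1;
  post_dead : forall q s, ~~ G q s -> ~~ D q s -> v q s <= 0;
  post_live : forall q s, live q s ->
    can s (fun mu => v q s <= l * dot mu (v (nx q))) }.

Definition Val q s : R := sup [set v q s | v in [set v | exists l, postfix l v]].

Lemma live_inv q : respects (live q).
Proof. by move=> s t st; rewrite /live (G_inv q st) (D_inv q st). Qed.

Lemma postfix_G : postfix 0 (fun q s => (G q s)%:R).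
Proof.
split=> [|q s t st|q s|q s|q s /negbTE-> _//|q s /andP[/negbTE-> _]].
- by rewrite lexx ltr01.
- by rewrite (G_inv q st).
- exact: ler0n.
- by rewrite lern1; case: (G q s).
- by apply: can_sub (can_true s) => mu _ _; rewrite mul0r.
Qed.

Lemma Val_ge l v q s : postfix l v -> v q s <= Val q s.
Proof.
move=> pv; apply: ub_le_sup; last by exists v => //; exists l.
by exists 1 => _ [w [k pw] <-]; exact: post_le1 pw _ _.
Qed.

Lemma Val_le q s c : (forall l v, postfix l v -> v q s <= c) -> Val q s <= c.
Proof.
move=> h; apply: ge_sup => [|_ [v [l pv] <-]]; last exact: h pv.
by exists (G q s)%:R, (fun q s => (G q s)%:R) => //; exists 0; exact: postfix_G.
Qed.

Lemma Val_inv q : respects (Val q).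
Proof.
by move=> s t st; apply/eqP; rewrite eq_le; apply/andP; split; apply: Val_le => l v pv;
  [rewrite (post_inv pv q st)|rewrite -(post_inv pv q st)]; exact: Val_ge pv.
Qed.

Lemma Val_ge0 q s : 0 <= Val q s.
Proof. by apply: le_trans (Val_ge q s postfix_G); exact: ler0n. Qed.

Lemma Val_le1 q s : Val q s <= 1.
Proof. by apply: Val_le => l v pv; exact: post_le1 pv _ _. Qed.

Lemma Val_G q s : G q s -> Val q s = 1.
Proof.
move=> Gq; apply/eqP; rewrite eq_le Val_le1/=.
by have := Val_ge q s postfix_G; rewrite Gq.
Qed.

Lemma Val_dead q s : ~~ G q s -> ~~ D q s -> Val q s = 0.
Proof.
move=> nG nD; apply/eqP; rewrite eq_le Val_ge0 andbT.
by apply: Val_le => l v pv; exact: post_dead pv _ _ nG nD.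
Qed.

Lemma postfix_max l1 l2 v1 v2 : postfix l1 v1 -> postfix l2 v2 ->
  postfix (Num.max l1 l2) (fun q s => Num.max (v1 q s) (v2 q s)).
Proof.
move=> p1 p2.
have /andP[l10 l11] := post_l p1; have /andP[l20 l21] := post_l p2.
split=> [|q s t st|q s|q s|q s nG nD|q s lq].
- by rewrite le_max l10 gt_max l11 l21.
- by rewrite (post_inv p1 q st) (post_inv p2 q st).
- by rewrite le_max (post_ge0 p1).
- by rewrite ge_max (post_le1 p1) (post_le1 p2).
- by rewrite ge_max (post_dead p1)// (post_dead p2).
have [_|_] := leP (v1 q s) (v2 q s).
  apply: can_sub (post_live p2 lq) => mu md /le_trans; apply.
  apply: ler_pM => //; first exact: dot_ge0 (post_ge0 p2 _).
    by rewrite le_max lexx orbT.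
  by apply: dot_le => [|s' _]; [case: md|rewrite le_max lexx orbT].
apply: can_sub (post_live p1 lq) => mu md /le_trans; apply.
apply: ler_pM => //; first exact: dot_ge0 (post_ge0 p1 _).
  by rewrite le_max lexx.
by apply: dot_le => [|s' _]; [case: md|rewrite le_max lexx].
Qed.

(** One post-fixpoint is close to [Val] at all the finitely many pairs at once: take the maximum of
    one witness per pair, which [postfix_max] allows. *)
Lemma Val_approx e : 0 < e ->
  exists l v, postfix l v /\ forall q s, Val q s - e < v q s.
Proof.
move=> e0.
have h (x : Q * S) : exists lv : R * (Q -> S -> R), postfix lv.1 lv.2 /\
    Val x.1 x.2 - e < lv.2 x.1 x.2.
  case: x => q s /=; apply: contrapT => /forallNP H.
  suff : Val q s <= Val q s - e by rewrite leNgt ltrBlDr ltrDl e0.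
  apply: Val_le => l v pv; rewrite leNgt; apply/negP => lt.
  by apply: (H (l, v)).
suff [l [v [pv H]]] : exists l v, postfix l v /\
    forall x, x \in enum [set: Q * S]%SET -> Val x.1 x.2 - e < v x.1 x.2.
  by exists l, v; split=> // q s; apply: (H (q, s)); rewrite mem_enum inE.
elim: (enum _) => [|x r [l [v [pv H]]]].
  by exists 0, (fun q s => (G q s)%:R); split=> //; exact: postfix_G.
have [[l1 v1] /= [pv1 H1]] := h x.
exists (Num.max l1 l), (fun q s => Num.max (v1 q s) (v q s)).
split; first exact: postfix_max.
move=> y; rewrite inE => /predU1P[->|/H yr]; rewrite lt_max ?H1//.
by rewrite yr orbT.
Qed.

(* Otherwise the whole class of s could be raised above Val. *)
Lemma Val_step_le q s e : live q s -> 0 < e ->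
  ~ can s (fun mu => Val q s + e <= dot mu (Val (nx q))).
Proof.
move=> lq e0 H.
have Hz : Val q s + e <= 1.
  have [mu [md]] := can_ex H; move/le_trans; apply.
  by apply: dot_lec => // s'; exact: Val_le1.
have V0 := Val_ge0 q s.
(* Of the surplus 4d, one d is lost by replacing [Val] with the approximation [v], and the discount
   1 - d costs at most another since values stay below 1. What remains covers the rise to
   [Val q s + d]. *)
pose d := e / 4; have d0 : 0 < d by rewrite /d; lra.
have [l [v [pv Hv]]] := Val_approx d0.
have /andP[l0 l1] := post_l pv.
pose l' := Num.max l (1 - d).
have l'l : l <= l' by rewrite le_max lexx.
have l'd : 1 - d <= l' by rewrite le_max lexx orbT.
have l'1 : l' < 1 by rewrite gt_max l1; lra.
have l'0 : 0 <= l' by exact: le_trans l'l.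
pose v' q' t := if (q' == q) && Rl s t then Val q s + d else v q' t.
have vv' q' t : v q' t <= v' q' t.
  rewrite /v'; case: ifP => // /andP[/eqP-> st].
  by rewrite (Val_inv q st); have := Val_ge q t pv; lra.
have v'0 q' t : 0 <= v' q' t by exact: le_trans (post_ge0 pv _ _) (vv' _ _).
have dotv mu q' : is_dist mu -> dot mu (v q') <= dot mu (v' q').
  by move=> md; apply: dot_le => [|t _]; [case: md|exact: vv'].
suff pv' : postfix l' v'.
  have := Val_ge q s pv'; rewrite /v' eqxx Rl_refl/=; lra.
split=> [|q' t u tu|//|q' t|q' t nG nD|q' t lq'].
- by rewrite l'0.
- rewrite /v' (post_inv pv q' tu); congr (if _ && _ then _ else _).
  by apply/idP/idP => h; apply: Rl_trans h _ => //; exact: Rl_sym.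
- rewrite /v'; case: ifP => _; last exact: post_le1 pv _ _.
  by move: Hz; rewrite /d; lra.
- rewrite /v'; case: ifP => [/andP[/eqP qE st]|_]; last exact: post_dead pv _ _ nG nD.
  by have := live_inv q st; rewrite lq -qE /live nG (negbTE nD).
have [c|/negP/negP nc] := boolP ((q' == q) && Rl s t); last first.
  rewrite {1}/v' (negbTE nc).
  apply: can_sub (post_live pv lq') => mu md /le_trans; apply.
  by apply: ler_pM => //; [exact: dot_ge0 (post_ge0 pv _)|exact: dotv].
rewrite {1}/v' c; move/andP: c => [/eqP -> st].
apply: can_sub (can_inv st (Val_inv _) H) => mu md h.
have h1 : dot mu (Val (nx q)) - d <= dot mu (v' (nx q)).
  apply: le_trans (dotv _ _ md); rewrite -dotDc//.
  by apply: dot_le => [|u _]; [case: md|exact: ltW].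
have h2 : Val q s + 3 * d <= dot mu (v' (nx q)) by move: h h1; rewrite /d; lra.
apply: (@le_trans _ _ ((1 - d) * (Val q s + 3 * d))).
  move: Hz V0; rewrite /d => ? ?; nra.
by apply: ler_pM => //; move: Hz; rewrite /d; lra.
Qed.

End Value.

(** * Mixing answers by a distribution on actions *)

Section Mix.
Variables (R : realType) (S A : finType).
Implicit Types (rho : A -> R) (m : A -> S -> R).

Definition mix rho m : S -> R := fun s' => \sum_a rho a * m a s'.

Definition dirac_dist (a : A) : A -> R := fun b => (b == a)%:R.

Lemma is_dist_dirac a : is_dist (dirac_dist a).
Proof.
split=> [b|]; first exact: ler0n.
by rewrite (bigD1 a)//= /dirac_dist eqxx big1 ?addr0// => b /negbTE->.
Qed.

Lemma mix_dirac a m : mix (dirac_dist a) m = m a.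
Proof.
apply/funext => s; rewrite /mix (bigD1 a)//= /dirac_dist eqxx mul1r big1 ?addr0//.
by move=> b /negbTE->; rewrite mul0r.
Qed.

Lemma dot_mix rho m f : dot (mix rho m) f = dot rho (fun a => dot (m a) f).
Proof.
rewrite /dot /mix; under eq_bigr do rewrite mulr_suml.
rewrite exchange_big/=; apply: eq_bigr => a _.
by rewrite mulr_sumr; apply: eq_bigr => s _; rewrite mulrA.
Qed.

Lemma is_dist_mix rho m : is_dist rho -> (forall a, is_dist (m a)) ->
  is_dist (mix rho m).
Proof.
move=> rd md; split=> [s|].
  by apply: sumr_ge0 => a _; rewrite mulr_ge0//; [case: rd|case: (md a)].
transitivity (dot (mix rho m) (fun=> 1)).
  by apply: eq_bigr => s _; rewrite mulr1.
by rewrite dot_mix -[RHS](dot_cst 1 rd); congr dot; apply/funext => a; rewrite dot_cst.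
Qed.

Lemma mix_gt0 rho m a s : is_dist rho -> (forall a, is_dist (m a)) ->
  0 < rho a -> 0 < m a s -> 0 < mix rho m s.
Proof.
move=> [r0 _] md ra ms; rewrite /mix (bigD1 a)//= ltr_pwDl ?mulr_gt0//.
by apply: sumr_ge0 => b _; rewrite mulr_ge0//; case: (md b).
Qed.

Lemma mix_gt0_ex rho m s : is_dist rho -> (forall a, is_dist (m a)) ->
  0 < mix rho m s -> exists a, 0 < rho a /\ 0 < m a s.
Proof.
move=> [r0 _] md; apply: contraPP => /forallNP h; apply/negP; rewrite -leNgt.
apply: sumr_le0 => a _; have := r0 a; rewrite le_eqVlt => /predU1P[<-|ra].
  by rewrite mul0r.
have := (md a).1 s; rewrite le_eqVlt => /predU1P[<-|ms]; first by rewrite mulr0.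
by case: (h a).
Qed.

End Mix.

(** * Bisimilar states have the same one-step power *)

Section ClassInvariance.
Variables (R : realType) (S A AP : finType) (I : S -> A -> S -> interval R).
Variables (L : S -> {set AP}) (Rl : rel S).
Hypothesis bisR : bisimulation L I Rl.

Let Rl_refl s : Rl s s. Proof. by case: bisR. Qed.
Let Rl_sym s t : Rl s t -> Rl t s. Proof. by case: bisR => _ [h _]; exact: h. Qed.
Let Rl_trans s t u : Rl s t -> Rl t u -> Rl s u.
Proof. by case: bisR => _ [_ [h _]]; exact: h. Qed.

Definition same_classes (mu nu : S -> R) :=
  forall c, \sum_(x | Rl c x) mu x = \sum_(x | Rl c x) nu x.

Lemma dot_same_classes mu nu f : same_classes mu nu -> respects Rl f ->
  dot mu f = dot nu f.
Proof.
move=> mn finv.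
(* A class representative: [pick] depends only on the extension of its predicate, so [r] is constant
   on classes and sums can be grouped along its fibres. *)
pose r s := odflt s [pick x | Rl s x].
have rE s t : Rl s t -> r s = r t.
  move=> st; rewrite /r.
  have e : Rl s =1 Rl t.
    by move=> x; apply/idP/idP => h; apply: Rl_trans h => //; exact: Rl_sym.
  rewrite (eq_pick e); case: pickP => // /(_ t); by rewrite Rl_refl.
have Rr s : Rl s (r s).
  by rewrite /r; case: pickP => [x//|/(_ s)]; rewrite Rl_refl.
have cls c s : (r s == r c) = Rl c s.
  apply/eqP/idP => [h|/rE//]; apply: Rl_trans (Rr c) _; rewrite -h; exact: Rl_sym.
rewrite /dot (partition_big r predT)//= [RHS](partition_big r predT)//=.
apply: eq_bigr => c _.
(* An index that is not its own representative has an empty fibre. *)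
have [rc|rc] := eqVneq (r c) c; last first.
  have e0 s : (r s == c) = false.
    apply/negbTE/eqP => e; move/eqP: rc; apply.
    by rewrite -{1}e -(rE _ _ (Rr s)).
  by rewrite !big_pred0.
rewrite -rc.
have h (m : S -> R) : \sum_(s | r s == r c) m s * f s = (\sum_(s | Rl c s) m s) * f c.
  rewrite (eq_bigl _ _ (cls c)) mulr_suml; apply: eq_bigr => s cs.
  by rewrite (finv _ _ cs).
by rewrite !h mn.
Qed.

Lemma hit_same_classes mu nu (X : S -> Prop) : is_dist mu -> is_dist nu ->
  same_classes mu nu -> respects Rl X ->
  (exists s', 0 < mu s' /\ X s') -> exists s', 0 < nu s' /\ X s'.
Proof.
move=> [m0 _] [n0 _] mn Xinv [s [ms Xs]]; apply: contrapT => /forallNP h.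
have : 0 < \sum_(x | Rl s x) mu x.
  by rewrite (bigD1 s)//= ltr_pwDl// sumr_ge0.
rewrite mn big1 ?ltxx// => x sx; apply/eqP; rewrite eq_le n0 andbT leNgt.
by apply/negP => nx; apply: (h x); rewrite -(Xinv _ _ sx).
Qed.

Definition class_based (T : (S -> R) -> Prop) := forall mu nu,
  is_dist mu -> is_dist nu -> same_classes mu nu -> T mu -> T nu.

Definition mix_closed (T : (S -> R) -> Prop) := forall (rho : A -> R) m,
  is_dist rho -> (forall a, is_dist (m a)) -> (forall a, T (m a)) -> T (mix rho m).

(** The scheduler moves first and nature answers, which makes the two powers dual through [canSN]
    and [canNS]. Pure actions stand for randomized ones, which is harmless for conditions whose
    failure survives mixing. *)
Definition canS s (T : (S -> R) -> Prop) := exists a, forall mu, Gamma I s a mu -> T mu.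
Definition canN s (T : (S -> R) -> Prop) := forall a, exists mu, Gamma I s a mu /\ T mu.

Lemma canSN s T : ~ canS s T <-> canN s (fun mu => ~ T mu).
Proof.
split=> [h a|h [a ha]]; last by have [mu [Gm nT]] := h a; exact/nT/ha.
apply: contrapT => /forallNP H; apply: h; exists a => mu Gm.
by apply: contrapT => nT; exact: (H mu).
Qed.

Lemma canNS s T : ~ canN s T <-> canS s (fun mu => ~ T mu).
Proof.
split=> [h|[a ha] h]; last by have [mu [Gm Tm]] := h a; exact: (ha mu).
apply: contrapT => /canSN H; apply: h => a.
by have [mu [Gm /contrapT Tm]] := H a; exists mu.
Qed.

(* Were no pure action good at t, mixing the bad answers would defeat the
   randomized action provided by the bisimulation. *)
Lemma canS_inv s t T : class_based T -> mix_closed (fun mu => ~ T mu) ->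
  Rl s t -> canS s T -> canS t T.
Proof.
move=> cT xT st [a ha]; apply: contrapT => /canSN/choice[m hm].
have [_ [_ [_ bis]]] := bisR.
have [_ /(_ _ (is_dist_dirac R a))[rho [rd h]]] := bis _ _ st.
have [|mu [[mus [Gmus muE]] cls]] := h (mix rho m).
  by exists m; split=> // a'; case: (hm a').
have muG : Gamma I s a mu.
  suff -> : mu = mus a by exact: Gmus.
  by rewrite -[RHS]mix_dirac; apply/funext => x; rewrite muE.
have md a' : is_dist (m a') by case: (hm a') => -[].
apply: (xT rho m) => // [a'|]; first by case: (hm a').
apply: cT (ha _ muG) => //; first by case: muG.
exact: is_dist_mix.
Qed.

(** By duality this is [canS_inv] for the complementary condition, applied from [t] back to [s]. *)
Lemma canN_inv s t T : class_based T -> mix_closed T ->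
  Rl s t -> canN s T -> canN t T.
Proof.
move=> cT xT st hs; apply: contrapT => /canNS ht; move: hs; apply/canNS.
apply: canS_inv (Rl_sym st) ht => [mu nu md nd mn nT Tn|rho m rd md h] /=.
  by apply: nT; apply: cT Tn => // c; rewrite mn.
by apply; apply: xT => // a; exact: contrapT.
Qed.

Lemma class_based_ge f c : respects Rl f -> class_based (fun mu => c <= dot mu f).
Proof. by move=> finv mu nu _ _ mn; rewrite (dot_same_classes mn finv). Qed.

Lemma mix_dot_ge (rho : A -> R) (m : A -> S -> R) f c : is_dist rho ->
  (forall a, 0 < rho a -> c <= dot (m a) f) -> c <= dot (mix rho m) f.
Proof.
move=> rd h; rewrite dot_mix -(dot_cst c rd).
by apply: dot_le => //; case: rd.
Qed.

Lemma mix_dot_le (rho : A -> R) (m : A -> S -> R) f c : is_dist rho ->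
  (forall a, 0 < rho a -> dot (m a) f <= c) -> dot (mix rho m) f <= c.
Proof.
move=> rd h; rewrite dot_mix -(dot_cst c rd).
by apply: dot_le => //; case: rd.
Qed.

Lemma mix_dot_gt (rho : A -> R) (m : A -> S -> R) f c a : is_dist rho ->
  (forall a, 0 < rho a -> c <= dot (m a) f) -> 0 < rho a -> c < dot (m a) f ->
  c < dot (mix rho m) f.
Proof.
move=> rd h ra ha; rewrite dot_mix -[ltLHS](dot_cst c rd).
by apply: dot_lt ra ha => //; case: rd.
Qed.

Lemma mix_dot_lt (rho : A -> R) (m : A -> S -> R) f c a : is_dist rho ->
  (forall a, 0 < rho a -> dot (m a) f <= c) -> 0 < rho a -> dot (m a) f < c ->
  dot (mix rho m) f < c.
Proof.
move=> rd h ra ha; rewrite dot_mix -[ltRHS](dot_cst c rd).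
by apply: dot_lt ra ha => //; case: rd.
Qed.

Lemma canS_ge_inv s t f c : Rl s t -> respects Rl f ->
  canS s (fun mu => c <= dot mu f) -> canS t (fun mu => c <= dot mu f).
Proof.
move=> st finv; apply: canS_inv => //; first exact: class_based_ge.
move=> rho m rd md h; have [a ra] := dist_ex_pos rd.
have h' b : dot (m b) f < c by rewrite ltNge; exact/negP.
apply/negP; rewrite -ltNge; apply: (mix_dot_lt rd _ ra (h' a)) => b _.
exact/ltW.
Qed.

Lemma canN_ge_inv s t f c : Rl s t -> respects Rl f ->
  canN s (fun mu => c <= dot mu f) -> canN t (fun mu => c <= dot mu f).
Proof.
move=> st finv; apply: canN_inv => //; first exact: class_based_ge.
by move=> rho m rd md h; apply: mix_dot_ge.
Qed.

Lemma canS_sub s (T T' : (S -> R) -> Prop) :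
  (forall mu, is_dist mu -> T mu -> T' mu) -> canS s T -> canS s T'.
Proof.
by move=> TT' [a h]; exists a => mu Gm; apply: TT'; [case: Gm|exact: h].
Qed.

Lemma canN_sub s (T T' : (S -> R) -> Prop) :
  (forall mu, is_dist mu -> T mu -> T' mu) -> canN s T -> canN s T'.
Proof.
move=> TT' h a; have [mu [Gm Tm]] := h a.
by exists mu; split=> //; apply: TT' => //; case: Gm.
Qed.

(** * Least fixpoints over sets of clocked states *)

Section LeastFixpoint.
Variables (Q : finType) (F : (Q -> S -> Prop) -> Q -> S -> Prop).
Hypothesis F_mono : forall X Y : Q -> S -> Prop,
  (forall q s, X q s -> Y q s) -> forall q s, F X q s -> F Y q s.

Definition lfp q s := forall X, (forall q s, F X q s -> X q s) -> X q s.

Lemma lfp_fold q s : F lfp q s -> lfp q s.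
Proof. by move=> h X FX; apply: (FX); apply: F_mono h => q' s'; apply. Qed.

(** The class-invariant core [P] of [lfp] is closed under [F], so by minimality it contains
    [lfp]. *)
Lemma lfp_inv : (forall X : Q -> S -> Prop, (forall q, respects Rl (X q)) ->
    forall q s t, Rl s t -> F X q s -> F X q t) ->
  forall q, respects Rl (lfp q).
Proof.
move=> F_inv.
pose P q s := forall t, Rl s t -> lfp q t.
have PI q : respects Rl (P q).
  move=> s t st; apply/propext; split=> h u hu; apply: h; apply: Rl_trans hu => //.
  exact: Rl_sym.
have lP q s : lfp q s -> P q s.
  apply=> {}q {}s h t st; apply: lfp_fold.
  apply: F_mono (F_inv _ PI _ _ _ st h) => q' s'; exact.
move=> q s t st; apply/propext; split=> /lP; apply => //; exact: Rl_sym.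
Qed.

End LeastFixpoint.

End ClassInvariance.

(** * Values and near-optimal strategies of both players *)

Section Game.
Variables (R : realType) (S A AP Q : finType) (I : S -> A -> S -> interval R).
Variables (L : S -> {set AP}) (Rl : rel S) (a0 : A).
Hypothesis bisR : bisimulation L I Rl.
Hypothesis Gamma_ex : forall s a, exists mu, Gamma I s a mu.
Variables (nx : Q -> Q) (G D : Q -> S -> bool).
Hypothesis G_inv : forall q, respects Rl (G q).
Hypothesis D_inv : forall q, respects Rl (D q).

Implicit Types (sg : seq S -> A -> R) (pi : seq S -> A -> S -> R).

Let Rl_refl s : Rl s s. Proof. by case: bisR. Qed.
Let Rl_sym s t : Rl s t -> Rl t s. Proof. by case: bisR => _ [h _]; exact: h. Qed.
Let Rl_trans s t u : Rl s t -> Rl t u -> Rl s u.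
Proof. by case: bisR => _ [_ [h _]]; exact: h. Qed.

Definition sched sg := forall u, is_dist (sg u).
Definition natr s pi := forall u a, Gamma I (last s u) a (pi u a).
Definition Kof sg pi : seq S -> S -> R := fun u => mix (sg u) (pi u).

Lemma stochastic_Kof s sg pi : sched sg -> natr s pi -> stochastic (Kof sg pi).
Proof. by move=> hs hp u; apply: is_dist_mix => // a; case: (hp u a). Qed.

Lemma sched_after sg s' : sched sg -> sched (after sg s').
Proof. by move=> h u; exact: (h (s' :: u)). Qed.

Lemma natr_after s pi s' : natr s pi -> natr s' (after pi s').
Proof. by move=> h u a; exact: (h (s' :: u) a). Qed.

Local Notation live := (live G D).
Local Notation reach := (reach nx G D).
Local Notation Rch q s sg pi := (Reach nx G D q s (Kof sg pi)).

(** [VS] is the value when the scheduler wants to reach the goal, [VN] the value when nature wants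
    it and the scheduler wants to avoid it. *)
Definition VS := Val nx G D Rl (canS I).
Definition VN := Val nx G D Rl (canN I).

Lemma canS_ex s T : canS I s T -> exists mu, is_dist mu /\ T mu.
Proof.
move=> [a h]; have [mu Gm] := Gamma_ex s a.
by exists mu; split; [case: Gm|exact: h].
Qed.

Lemma canN_ex s T : canN I s T -> exists mu, is_dist mu /\ T mu.
Proof. by move=> /(_ a0)[mu [[md _] Tm]]; exists mu. Qed.

Lemma canS_true s : canS I s (fun=> True).
Proof. by exists a0. Qed.

Lemma canN_true s : canN I s (fun=> True).
Proof. by move=> a; have [mu Gm] := Gamma_ex s a; exists mu. Qed.

Let canS_sub := @canS_sub R S A I.
Let canN_sub := @canN_sub R S A I.

Lemma VS_inv q : respects Rl (VS q).
Proof. exact: (Val_inv nx D G_inv canS_sub canS_true). Qed.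
Lemma VN_inv q : respects Rl (VN q).
Proof. exact: (Val_inv nx D G_inv canN_sub canN_true). Qed.
Lemma VS_ge0 q s : 0 <= VS q s.
Proof. exact: (Val_ge0 nx D G_inv canS_sub canS_true). Qed.
Lemma VN_ge0 q s : 0 <= VN q s.
Proof. exact: (Val_ge0 nx D G_inv canN_sub canN_true). Qed.
Lemma VN_le1 q s : VN q s <= 1.
Proof. exact: (Val_le1 nx D G_inv canN_sub canN_true). Qed.
Lemma VS_G q s : G q s -> VS q s = 1.
Proof. exact: (Val_G nx D G_inv canS_sub canS_true). Qed.
Lemma VN_G q s : G q s -> VN q s = 1.
Proof. exact: (Val_G nx D G_inv canN_sub canN_true). Qed.
Lemma VN_dead q s : ~~ G q s -> ~~ D q s -> VN q s = 0.
Proof. exact: (Val_dead nx G_inv canN_sub canN_true). Qed.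

Lemma VS_step_le q s e : live q s -> 0 < e ->
  ~ canS I s (fun mu => VS q s + e <= dot mu (VS (nx q))).
Proof.
exact: (Val_step_le Rl_refl Rl_sym Rl_trans G_inv D_inv canS_sub canS_ex
  canS_true (@canS_ge_inv _ _ _ _ _ _ _ bisR)).
Qed.

Lemma VN_step_le q s e : live q s -> 0 < e ->
  ~ canN I s (fun mu => VN q s + e <= dot mu (VN (nx q))).
Proof.
exact: (Val_step_le Rl_refl Rl_sym Rl_trans G_inv D_inv canN_sub canN_ex
  canN_true (@canN_ge_inv _ _ _ _ _ _ _ bisR)).
Qed.

(** By [VS_step_le] nature can answer every action so that [VS] rises by at most any prescribed
    slack. The slacks e / 2 ^+ k.+1 at histories of length k add up to at most e, and the answers
    are chosen before the scheduler is known. *)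
Lemma spoilS e q s : 0 < e ->
  exists pi, natr s pi /\ forall sg, sched sg -> Rch q s sg pi <= VS q s + e.
Proof.
move=> e0.
have /choice[m hm] (x : Q * S * R * A) : exists mu, let: (q, s, e, a) := x in
    Gamma I s a mu /\ (0 < e -> live q s -> dot mu (VS (nx q)) <= VS q s + e).
  case: x => [[[q' s'] e'] a].
  have [[e'0 lq]|n] := pselect (0 < e' /\ live q' s').
    have /canSN/(_ a)[mu [Gm /negP]] := VS_step_le lq e'0.
    by rewrite -ltNge => h; exists mu; split=> // _ _; exact: ltW.
  by have [mu Gm] := Gamma_ex s' a; exists mu; split=> // h h'; case: n.
exists (fun u a => m (clk nx q u, last s u, e / 2 ^+ (size u).+1, a)).
have nat : natr s (fun u a => m (clk nx q u, last s u, e / 2 ^+ (size u).+1, a)).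
  by move=> u a; case: (hm (clk nx q u, last s u, e / 2 ^+ (size u).+1, a)).
split=> // sg hs; apply: Reach_upper => //.
- exact: ltW.
- exact: stochastic_Kof nat.
- exact: VS_ge0.
- exact: VS_G.
move=> u lu; apply: mix_dot_le => // a _.
have [_] := hm (clk nx q u, last s u, e / 2 ^+ (size u).+1, a).
by apply=> //; rewrite divr_gt0// exprn_gt0.
Qed.

(** For each e an approximating post-fixpoint yields a choice of actions depending on clock and
    state only. There are finitely many such choices, so one of them serves all e. *)
Lemma optS : exists sg : Q -> S -> seq S -> A -> R, forall q s,
  sched (sg q s) /\ forall pi, natr s pi -> VS q s <= Rch q s (sg q s) pi.
Proof.
have [d hd] : exists d : {ffun Q * S -> A}, forall e, 0 < e -> exists l v,
    [/\ postfix nx G D Rl (canS I) l v, forall q s, VS q s - e < v q s &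
     forall q s, live q s -> forall mu, Gamma I s (d (q, s)) mu ->
       v q s <= l * dot mu (v (nx q))].
  apply: fin_limit_choice => [d e e' ee' [l [v [pv h1 h2]]]|e e0].
    by exists l, v; split=> // q s; have := h1 q s; lra.
  have [l [v [pv h]]] := Val_approx nx D G_inv canS_sub canS_true e0.
  have /choice[f hf] (x : Q * S) : exists a, live x.1 x.2 ->
      forall mu, Gamma I x.2 a mu -> v x.1 x.2 <= l * dot mu (v (nx x.1)).
    have [lx|nl] := boolP (live x.1 x.2); last by exists a0.
    by have [a ha] := post_live pv lx; exists a.
  exists [ffun x => f x], l, v; split=> // q s lq mu; rewrite ffunE => Gm.
  exact: (hf (q, s)).
exists (fun q s u => dirac_dist R (d (clk nx q u, last s u))) => q s.
have sch : sched (fun u => dirac_dist R (d (clk nx q u, last s u))).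
  by move=> u; exact: is_dist_dirac.
split=> // pi hp; apply: le_of_eps => e e0.
have [l [v [pv h1 h2]]] := hd e e0.
suff : v q s <= Rch q s (fun u => dirac_dist R (d (clk nx q u, last s u))) pi.
  by have := h1 q s; lra.
apply: (Reach_lower (post_l pv)).
- exact: stochastic_Kof hp.
- exact: post_le1 pv.
- exact: post_dead pv.
by move=> u lu; rewrite /Kof mix_dirac; exact: h2.
Qed.

(** Nature answers each action so that a near-optimal post-fixpoint does not drop in a discounted
    step; this inequality survives the mixing done by the scheduler. As the sets [Gamma] need not be
    closed, an error e remains. *)
Lemma approxN e q s : 0 < e ->
  exists pi, natr s pi /\ forall sg, sched sg -> VN q s - e <= Rch q s sg pi.
Proof.
move=> e0.
have [l [v [pv h]]] := Val_approx nx D G_inv canN_sub canN_true e0.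
have /choice[m hm] (x : Q * S * A) : exists mu, let: (q, s, a) := x in
    Gamma I s a mu /\ (live q s -> v q s <= l * dot mu (v (nx q))).
  case: x => [[q' s'] a].
  have [lx|nl] := boolP (live q' s').
    by have [mu [Gm hmu]] := post_live pv lx a; exists mu.
  by have [mu Gm] := Gamma_ex s' a; exists mu.
exists (fun u a => m (clk nx q u, last s u, a)).
have nat : natr s (fun u a => m (clk nx q u, last s u, a)).
  by move=> u a; case: (hm (clk nx q u, last s u, a)).
split=> // sg hs.
suff : v q s <= Rch q s sg (fun u a => m (clk nx q u, last s u, a)).
  by have := h q s; rewrite /VN; lra.
apply: (Reach_lower (post_l pv)).
- exact: stochastic_Kof nat.
- exact: post_le1 pv.
- exact: post_dead pv.
move=> u lu; have /andP[l0 l1] := post_l pv.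
have hmu a : v (clk nx q u) (last s u) <=
    l * dot (m (clk nx q u, last s u, a)) (v (nx (clk nx q u))).
  by have [_] := hm (clk nx q u, last s u, a); apply.
have dotZ mu f : l * dot mu f = dot mu (fun s => l * f s).
  by rewrite /dot mulr_sumr; apply: eq_bigr => x _; rewrite mulrCA.
by rewrite dotZ; apply: mix_dot_ge => // a _; rewrite -dotZ.
Qed.

(** For every slack some action keeps the rise of [VN] within it; with finitely many actions a
    single one serves all slacks, and the error vanishes. *)
Lemma VN_action q s : live q s ->
  exists a, forall mu, Gamma I s a mu -> dot mu (VN (nx q)) <= VN q s.
Proof.
move=> lq.
have [a ha] : exists a, forall e, 0 < e ->
    forall mu, Gamma I s a mu -> dot mu (VN (nx q)) <= VN q s + e.
  apply: fin_limit_choice => [a e e' ee' h mu /h|e e0]; first by lra.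
  have /canNS[a ha] := VN_step_le lq e0; exists a => mu /ha/negP.
  by rewrite -ltNge; exact: ltW.
by exists a => mu Gm; apply: le_of_eps => e e0; exact: ha.
Qed.

(** Playing the action of [VN_action] everywhere makes [VN] superharmonic, so [Reach_upper] applies
    with zero error. *)
Lemma optN : exists sg : Q -> S -> seq S -> A -> R, forall q s,
  sched (sg q s) /\ forall pi, natr s pi -> Rch q s (sg q s) pi <= VN q s.
Proof.
have /choice[d hd] (x : Q * S) : exists a, live x.1 x.2 ->
    forall mu, Gamma I x.2 a mu -> dot mu (VN (nx x.1)) <= VN x.1 x.2.
  have [lx|nl] := boolP (live x.1 x.2); last by exists a0.
  by have [a ha] := VN_action lx; exists a.
exists (fun q s u => dirac_dist R (d (clk nx q u, last s u))) => q s.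
have sch : sched (fun u => dirac_dist R (d (clk nx q u, last s u))).
  by move=> u; exact: is_dist_dirac.
split=> // pi hp; rewrite -[leRHS]addr0; apply: Reach_upper => //.
- exact: stochastic_Kof hp.
- exact: VN_ge0.
- exact: VN_G.
move=> u lu; rewrite mul0r addr0 /Kof mix_dirac.
exact: (hd (clk nx q u, last s u) lu _ (hp _ _)).
Qed.

Lemma after_Kof sg pi s' : after (Kof sg pi) s' = Kof (after sg s') (after pi s').
Proof. by []. Qed.

Lemma Rch_step q s sg pi : sched sg -> natr s pi -> live q s ->
  Rch q s sg pi = dot (mix (sg [::]) (pi [::]))
    (fun s' => Rch (nx q) s' (after sg s') (after pi s')).
Proof. by move=> hs hp lq; rewrite Reach_step//; exact: stochastic_Kof hp. Qed.

(** A strategy of nature against a known scheduler: it answers with [m] up to and including the step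
    where the scheduler's distribution triggers [sw], then commits to [alt]. Passing that
    distribution to [alt] lets the continuation depend on the margin just gained. *)
Fixpoint follow (m : Q -> S -> A -> S -> R) (sw : Q -> S -> (A -> R) -> bool)
    (alt : Q -> S -> (A -> R) -> S -> seq S -> A -> S -> R) q s sg u
    {struct u} : A -> S -> R :=
  if u is s' :: u' then
    if sw q s (sg [::]) then alt q s (sg [::]) s' u'
    else follow m sw alt (nx q) s' (after sg s') u'
  else m q s.

Lemma after_follow m sw alt q s sg s' :
  after (follow m sw alt q s sg) s' =
  if sw q s (sg [::]) then alt q s (sg [::]) s'
  else follow m sw alt (nx q) s' (after sg s').
Proof. by apply/funext => u; rewrite /after/=; case: ifP. Qed.

Lemma natr_follow m sw alt q s sg :
  (forall q s a, Gamma I s a (m q s a)) ->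
  (forall q s rho s', natr s' (alt q s rho s')) ->
  natr s (follow m sw alt q s sg).
Proof.
move=> hm ha u; elim: u q s sg => [|s' u IH] q s sg a /=; first exact: hm.
by case: ifP => _; [exact: ha|exact: IH].
Qed.

(** * Beating the value strictly when the scheduler wants the goal *)

Section StrictMax.

(** [X] collects states where a strict win is already secured: the scheduler exceeds the value at
    once, or keeps it and enters [X] with positive probability. *)
Let TS (X : Q -> S -> Prop) q c (mu : S -> R) :=
  c < dot mu (VS (nx q)) \/
  (c <= dot mu (VS (nx q)) /\ exists s', 0 < mu s' /\ X (nx q) s').
Let FS (X : Q -> S -> Prop) q s := live q s /\ canS I s (TS X q (VS q s)).

Definition BS := lfp FS.

Let FS_mono (X Y : Q -> S -> Prop) :
  (forall q s, X q s -> Y q s) -> forall q s, FS X q s -> FS Y q s.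
Proof.
move=> XY q s [lq h]; split=> //; apply: canS_sub h => mu _ [h|[h [s' [ms Xs]]]].
  by left.
by right; split=> //; exists s'; split=> //; exact: XY.
Qed.

Lemma BS_inv q : respects Rl (BS q).
Proof.
apply: (lfp_inv bisR FS_mono) => X XI {}q s t st [lq h]; split.
  by rewrite -(live_inv G_inv D_inv q st).
rewrite -(VS_inv q st); apply: (canS_inv bisR) st h.
  move=> mu nu md nd mn; rewrite /TS (dot_same_classes bisR mn (VS_inv _)).
  case=> [|[? h]]; first by left.
  by right; split=> //; exact: (hit_same_classes bisR md nd mn (XI _) h).
(* Answers violating [TS] never exceed the value, and those hitting [X] fall strictly below it. A
   mixture that hits [X] therefore falls below it too. *)
move=> rho m rd md h.
have le a : dot (m a) (VS (nx q)) <= VS q s.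
  by rewrite leNgt; apply/negP => lt; apply: (h a); left.
case=> [|[le' [s' [ms Xs]]]].
  by rewrite ltNge mix_dot_le.
have [a [ra ma]] := mix_gt0_ex rd md ms.
move: le'; apply/negP; rewrite -ltNge; apply: (mix_dot_lt rd _ ra) => //.
rewrite ltNge; apply/negP => ge; apply: (h a); right; split=> //.
by exists s'.
Qed.

(** Induction over the least fixpoint with the conclusion as [P]: after the first action, follow a
    strictly winning strategy wherever one exists and an optimal one elsewhere. *)
Lemma BS_sched q s : BS q s -> exists sg, sched sg /\
  forall pi, natr s pi -> VS q s < Rch q s sg pi.
Proof.
pose P q s := exists sg, sched sg /\ forall pi, natr s pi -> VS q s < Rch q s sg pi.
have [opt hopt] := optS.
move=> B; apply: (B P) => {B}q {}s [lq [a ha]].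
have /choice[sg' hsg'] s' : exists sg, [/\ sched sg,
    forall pi, natr s' pi -> VS (nx q) s' <= Rch (nx q) s' sg pi &
    P (nx q) s' -> forall pi, natr s' pi -> VS (nx q) s' < Rch (nx q) s' sg pi].
  have [[sg [h1 h2]]|nP] := pselect (P (nx q) s').
    by exists sg; split=> // pi /h2; exact: ltW.
  by exists (opt (nx q) s'); have [h1 h2] := hopt (nx q) s'; split.
pose sg u := if u is s' :: u' then sg' s' u' else dirac_dist R a.
have hsg : sched sg.
  by case=> [|s' u] /=; [exact: is_dist_dirac|case: (hsg' s')].
exists sg; split=> // pi hp; rewrite Rch_step//= mix_dirac.
have Gm : Gamma I s a (pi [::] a) by exact: (hp [::]).
have m0 : forall s', 0 <= pi [::] a s' by case: Gm => -[].
have le s' : VS (nx q) s' <= Rch (nx q) s' (after sg s') (after pi s').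
  by case: (hsg' s') => _ + _; apply; exact: natr_after hp.
have [lt|[ge [s' [ms Ps]]]] := ha _ Gm.
  by apply: lt_le_trans lt _; exact: dot_le.
apply: le_lt_trans ge _; apply: dot_lt ms _ => //.
by case: (hsg' s') => _ _; apply=> //; exact: natr_after hp.
Qed.

(** Outside [BS] every action has an answer violating [TS]. If the resulting mixture loses value,
    the loss [gap] pays for the error of [spoilS] and nature switches to it. Otherwise each action
    played keeps the value exactly, hence avoids [BS], and the argument repeats at the
    successors. *)
Lemma BS_natr q s sg : ~ BS q s -> sched sg ->
  exists pi, natr s pi /\ Rch q s sg pi <= VS q s.
Proof.
have /choice[m0 hm0] (x : Q * S * A) : exists mu, let: (q, s, a) := x in
    Gamma I s a mu /\ (~ BS q s -> live q s -> ~ TS BS q (VS q s) mu).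
  case: x => [[q' s'] a].
  have [[nB lq]|n] := pselect (~ BS q' s' /\ live q' s').
    have nF : ~ canS I s' (TS BS q' (VS q' s')).
      by move=> h; apply: nB; apply: (lfp_fold FS_mono).
    by have /canSN/(_ a)[mu [Gm h]] := nF; exists mu.
  by have [mu Gm] := Gamma_ex s' a; exists mu; split=> // h h'; case: n.
pose m q s a := m0 (q, s, a).
have hm q' s' a : Gamma I s' a (m q' s' a) by case: (hm0 (q', s', a)).
have hmB q' s' a : ~ BS q' s' -> live q' s' -> ~ TS BS q' (VS q' s') (m q' s' a).
  by case: (hm0 (q', s', a)) => _.
have /choice[sp hsp] (x : Q * S * R) : exists pi, let: (q, s, e) := x in natr s pi /\
    (0 < e -> forall sg, sched sg -> Rch q s sg pi <= VS q s + e).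
  case: x => [[q' s'] e]; have [e0|ne] := pselect (0 < e).
    by have [pi [h1 h2]] := spoilS q' s' e0; exists pi.
  by have [pi [h1 h2]] := spoilS q' s' ltr01; exists pi; split=> // /ne.
pose gap q s rho := VS q s - dot (mix rho (m q s)) (VS (nx q)).
pose alt q s rho s' := sp (nx q, s', gap q s rho).
have halt q' s' rho t : natr t (alt q' s' rho t).
  by case: (hsp (nx q', t, gap q' s' rho)).
pose sw q s rho := 0 < gap q s rho.
move=> nB hs; exists (follow m sw alt q s sg).
split; first exact: natr_follow.
apply: Reach_le => n; elim: n q s sg nB hs => [|n IH] q' s' sg' nB hs;
  case: (statusP G D q' s') => [Gq|nG nD|lq].
- by rewrite reach_G// VS_G.
- by rewrite reach_dead// VS_ge0.
- by rewrite reach0// VS_ge0.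
- by rewrite reach_G// VS_G.
- by rewrite reach_dead// VS_ge0.
rewrite reach_live//.
rewrite (_ : dot _ _ = dot (mix (sg' [::]) (m q' s')) (fun t =>
    reach n (nx q') t (Kof (after sg' t)
      (if sw q' s' (sg' [::]) then alt q' s' (sg' [::]) t
       else follow m sw alt (nx q') t (after sg' t))))); last first.
  by congr dot; apply/funext => t; rewrite -after_follow.
have md a : is_dist (m q' s' a) by case: (hm q' s' a).
have mixd := is_dist_mix (hs [::]) md.
have le a : dot (m q' s' a) (VS (nx q')) <= VS q' s'.
  by rewrite leNgt; apply/negP => lt; apply: (hmB q' s' a nB lq); left.
case: (boolP (sw q' s' (sg' [::]))) => [sw1|]; last first.
  rewrite /sw -leNgt subr_le0 => gele.
  apply: (@le_trans _ _ (dot (mix (sg' [::]) (m q' s')) (VS (nx q')))); last first.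
    exact: mix_dot_le.
  apply: dot_le => [|t mt]; first by case: mixd.
  apply: IH (sched_after t hs) => Bt.
  have [a [ra ma]] := mix_gt0_ex (hs [::]) md mt.
  move: gele; apply/negP; rewrite -ltNge.
  apply: (mix_dot_lt (hs [::]) _ ra) => //.
  rewrite ltNge; apply/negP => ge; apply: (hmB q' s' a nB lq); right.
  by split=> //; exists t.
apply: (@le_trans _ _ (dot (mix (sg' [::]) (m q' s'))
  (fun t => VS (nx q') t + gap q' s' (sg' [::])))).
  apply: dot_le => [|t _]; first by case: mixd.
  apply: le_trans (Reach_ge _ _ _ _ _ _ _) _.
    exact: stochastic_Kof (sched_after t hs) (halt _ _ _ _).
  case: (hsp (nx q', t, gap q' s' (sg' [::]))) => _; apply=> //.
  exact: sched_after.
by rewrite dotDc// /gap addrC subrK.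
Qed.

End StrictMax.

(** * Beating the value strictly when the scheduler avoids the goal *)

Section StrictMin.

(** [X] collects states where the scheduler already wins strictly, and [Z] states from which nature
    is already known to make progress. *)
Let TN (X Z : Q -> S -> Prop) q c (mu : S -> R) :=
  c < dot mu (VN (nx q)) \/
  [/\ c <= dot mu (VN (nx q)), forall s', 0 < mu s' -> ~ X (nx q) s' &
      exists s', 0 < mu s' /\ Z (nx q) s'].

(* States from which nature, never losing value nor entering [X], makes
   progress within [k] steps; [FN] collects the states where it cannot. *)
Fixpoint ZN (X : Q -> S -> Prop) k q s : Prop :=
  if k is k'.+1 then
    [\/ ~~ live q s, VN q s <= 0 | canN I s (TN X (ZN X k') q (VN q s))]
  else False.

Let FN (X : Q -> S -> Prop) q s := forall k, ~ ZN X k q s.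

(** Two fixpoints alternate: the stages [ZN X k] grow in [k], and the complement of their union
    feeds the outer least fixpoint. Unlike for [BS], the scheduler may also win strictly by
    remaining forever among states of positive value without meeting the goal. *)
Definition BN := lfp FN.

Let TN_sub (X X' Z Z' : Q -> S -> Prop) q c mu :
  (forall q s, X' q s -> X q s) -> (forall q s, Z q s -> Z' q s) ->
  TN X Z q c mu -> TN X' Z' q c mu.
Proof.
move=> XX ZZ [h|[h1 h2 [s' [ms Zs]]]]; first by left.
right; split=> //; first by move=> t /h2 nX /XX.
by exists s'; split=> //; exact: ZZ.
Qed.

Lemma ZN_anti X Y k q s : (forall q s, X q s -> Y q s) -> ZN Y k q s -> ZN X k q s.
Proof.
move=> XY; elim: k q s => [//|k IH] q s /= [h|h|h]; [exact: Or31|exact: Or32|].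
by apply: Or33; apply: canN_sub h => mu _; exact: TN_sub.
Qed.

Lemma ZN_leS X k q s : ZN X k q s -> ZN X k.+1 q s.
Proof.
elim: k q s => [//|k IH] q s [h|h|h]; [exact: Or31|exact: Or32|].
by apply: Or33; apply: canN_sub h => mu _; exact: TN_sub.
Qed.

Lemma ZN_le X k l q s : (k <= l)%N -> ZN X k q s -> ZN X l q s.
Proof.
move=> /subnK <-; elim: (l - k)%N => [//|j IH] h; rewrite addSn.
by apply: ZN_leS; exact: IH.
Qed.

Let FN_mono (X Y : Q -> S -> Prop) :
  (forall q s, X q s -> Y q s) -> forall q s, FN X q s -> FN Y q s.
Proof. by move=> XY q s h k Z; apply: (h k); exact: ZN_anti Z. Qed.

Lemma ZN_inv X k q : (forall q, respects Rl (X q)) -> respects Rl (ZN X k q).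
Proof.
move=> XI; elim: k q => [//|k IH] q.
suff h s t : Rl s t -> ZN X k.+1 q s -> ZN X k.+1 q t.
  by move=> s t st; apply/propext; split; apply: h => //; exact: Rl_sym.
move=> st; rewrite /= (live_inv G_inv D_inv q st) (VN_inv q st).
case=> h; [exact: Or31|exact: Or32|apply: Or33].
apply: (canN_inv bisR) st h.
  move=> mu nu md nd mn; rewrite /TN (dot_same_classes bisR mn (VN_inv _)).
  case=> [|[h1 h2 h3]]; [by left|right; split=> //].
    move=> s' ns Xs.
    have nm : same_classes Rl nu mu by move=> c; rewrite mn.
    have [|u [mu0 Xu]] := hit_same_classes bisR nd md nm (XI (nx q)) _.
      by exists s'.
    exact: (h2 u).
  exact: (hit_same_classes bisR md nd mn (IH _)).
move=> rho m rd md h.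
have ge a : VN q t <= dot (m a) (VN (nx q)) by case: (h a) => [/ltW//|[]].
(* Either some action played gains strictly, and so does the mixture, or all actions played avoid
   [X] and hit the previous stage, which the mixture inherits. *)
have [[a [ra gt]]|/forallNP ngt] :=
    pselect (exists a, 0 < rho a /\ VN q t < dot (m a) (VN (nx q))).
  by left; apply: (mix_dot_gt rd _ ra).
have h' a : 0 < rho a -> (forall s', 0 < m a s' -> ~ X (nx q) s') /\
    exists s', 0 < m a s' /\ ZN X k (nx q) s'.
  by move=> ra; case: (h a) => [gt|[]//]; case: (ngt a).
right; split; first exact: mix_dot_ge.
  move=> s' /(mix_gt0_ex rd md)[a [ra ma]].
  by have [+ _] := h' a ra; apply.
have [a ra] := dist_ex_pos rd; have [_ [s' [ma Zs]]] := h' a ra.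
by exists s'; split=> //; exact: mix_gt0 ra ma.
Qed.

Lemma BN_inv q : respects Rl (BN q).
Proof.
apply: (lfp_inv bisR FN_mono) => X XI {}q s t st h k.
by rewrite -(ZN_inv k q XI st).
Qed.

(** If each action could be answered by progress at some stage, monotonicity and finiteness would
    give a common stage [k], and nature would progress at stage [k.+1]. So one action resists at all
    stages. *)
Let FN_action X q s : FN X q s -> exists a, forall mu, Gamma I s a mu ->
  dot mu (VN (nx q)) <= VN q s /\
  [\/ dot mu (VN (nx q)) < VN q s, exists s', 0 < mu s' /\ X (nx q) s' |
      forall s', 0 < mu s' -> FN X (nx q) s'].
Proof.
move=> h.
have [a ha] : exists a, forall k mu, Gamma I s a mu -> ~ TN X (ZN X k) q (VN q s) mu.
  apply: contrapT => /forallNP H.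
  have [k hk] : exists k, forall a, exists mu, Gamma I s a mu /\
      TN X (ZN X k) q (VN q s) mu.
    apply: fin_uniform_nat => [a k l kl [mu [Gm T]]|a].
      by exists mu; split=> //; apply: TN_sub T => // q' s'; exact: ZN_le.
    have /existsNP[k /existsNP[mu /not_implyP[Gm /contrapT T]]] := H a.
    by exists k, mu.
  by apply: (h k.+1); apply: Or33.
exists a => mu Gm.
have le : dot mu (VN (nx q)) <= VN q s.
  by rewrite leNgt; apply/negP => lt; apply: (ha 0%N mu Gm); left.
split=> //.
have [lt|ge] := ltP (dot mu (VN (nx q))) (VN q s); first exact: Or31.
have [hit|nhit] := pselect (exists s', 0 < mu s' /\ X (nx q) s').
  exact: Or32.
apply: Or33 => s' ms k Z; apply: (ha k mu Gm); right; split=> //.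
  by move=> t mt Xt; apply: nhit; exists t.
by exists s'.
Qed.

(** Again induction over the least fixpoint. The strategy [stay] plays resisting actions inside
    [FN P], switches to a winning strategy on entering [P], and to an optimal one on leaving both;
    by [c1] this never yields more than [VN]. *)
Lemma BN_sched q s : BN q s -> exists sg, sched sg /\
  forall pi, natr s pi -> Rch q s sg pi < VN q s.
Proof.
pose P q s := exists sg, sched sg /\ forall pi, natr s pi -> Rch q s sg pi < VN q s.
have [opt hopt] := optN.
have /choice[win hwin] (x : Q * S) : exists sg, sched sg /\ (P x.1 x.2 ->
    forall pi, natr x.2 pi -> Rch x.1 x.2 sg pi < VN x.1 x.2).
  have [[sg [h1 h2]]|nP] := pselect (P x.1 x.2); first by exists sg.
  by exists (opt x.1 x.2); split=> //; case: (hopt x.1 x.2).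
have /choice[d hd] (x : Q * S) : exists a, FN P x.1 x.2 ->
    forall mu, Gamma I x.2 a mu -> dot mu (VN (nx x.1)) <= VN x.1 x.2 /\
    [\/ dot mu (VN (nx x.1)) < VN x.1 x.2, exists s', 0 < mu s' /\ P (nx x.1) s' |
        forall s', 0 < mu s' -> FN P (nx x.1) s'].
  have [Fx|nF] := pselect (FN P x.1 x.2); last by exists a0.
  by have [a ha] := FN_action Fx; exists a.
pose stay := fix stay q s (u : seq S) : A -> R :=
  if u is s' :: u' then
    if `[< P (nx q) s' >] then win (nx q, s') u'
    else if `[< FN P (nx q) s' >] then stay (nx q) s' u' else opt (nx q) s' u'
  else dirac_dist R (d (q, s)).
have stayP q' s' t : P (nx q') t -> after (stay q' s') t = win (nx q', t).
  by move=> /asboolP Pt; apply/funext => u; rewrite /after/= Pt.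
have stayF q' s' t : ~ P (nx q') t -> FN P (nx q') t ->
    after (stay q' s') t = stay (nx q') t.
  by move=> /asboolPn/negbTE Pt /asboolP Ft; apply/funext => u; rewrite /after/= Pt Ft.
have stayN q' s' t : ~ P (nx q') t -> ~ FN P (nx q') t ->
    after (stay q' s') t = opt (nx q') t.
  move=> /asboolPn/negbTE Pt /asboolPn/negbTE Ft; apply/funext => u.
  by rewrite /after/= Pt Ft.
have hstay q' s' : sched (stay q' s').
  move=> u; elim: u q' s' => [|t u IH] q' s' /=; first exact: is_dist_dirac.
  case: ifP => _; first by case: (hwin (nx q', t)).
  by case: ifP => _; [exact: IH|case: (hopt (nx q') t)].
have FNlive q' s' : FN P q' s' -> live q' s' /\ 0 < VN q' s'.
  move=> h; split; first by apply: contrapT => /negP nl; apply: (h 1%N); exact: Or31.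
  by rewrite ltNge; apply/negP => le; apply: (h 1%N); exact: Or32.
have Gd q' s' pi : natr s' pi -> Gamma I s' (d (q', s')) (pi [::] (d (q', s'))).
  by move=> hp; exact: (hp [::]).
have Kst q' s' pi : Kof (stay q' s') pi [::] = pi [::] (d (q', s')).
  by rewrite /Kof /= mix_dirac.
have c1 n q' s' pi : FN P q' s' -> natr s' pi ->
    reach n q' s' (Kof (stay q' s') pi) <= VN q' s'.
  elim: n q' s' pi => [|n IH] q' s' pi F hp; have [lq V0] := FNlive _ _ F.
    by rewrite reach0// ltW.
  rewrite reach_live// Kst.
  have [le _] := hd (q', s') F _ (Gd q' s' pi hp).
  apply: le_trans le; apply: dot_le => [|t mt]; first by case: (Gd q' s' pi hp) => -[].
  have hpt := natr_after t hp.
  rewrite after_Kof.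
  have [Pt|nP] := pselect (P (nx q') t).
    rewrite stayP//; case: (hwin (nx q', t)) => /= hs /(_ Pt _ hpt)/ltW.
    apply: le_trans; apply: Reach_ge; exact: stochastic_Kof hpt.
  have [Ft|nF] := pselect (FN P (nx q') t); first by rewrite stayF//; exact: IH.
  rewrite stayN//; case: (hopt (nx q') t) => /= hs /(_ _ hpt).
  apply: le_trans; apply: Reach_ge; exact: stochastic_Kof hpt.
have c1' q' s' pi t : FN P q' s' -> natr s' pi -> 0 < pi [::] (d (q', s')) t ->
    Rch (nx q') t (after (stay q' s') t) (after pi t) <= VN (nx q') t.
  move=> F hp mt; have hpt := natr_after t hp.
  have [Pt|nP] := pselect (P (nx q') t).
    by rewrite stayP//; case: (hwin (nx q', t)) => /= hs /(_ Pt _ hpt)/ltW.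
  have [Ft|nF] := pselect (FN P (nx q') t).
    by rewrite stayF//; apply: Reach_le => n; exact: c1.
  by rewrite stayN//; case: (hopt (nx q') t) => /= hs; exact.
(* If nature attained [VN], no step could lose value, so the play could neither enter [P] nor leave
   [FN P]. All its states are then live, the goal is never met, and the probability 0 contradicts
   the positive value on [FN P]. *)
have c2 n q' s' pi : FN P q' s' -> natr s' pi ->
    VN q' s' <= Rch q' s' (stay q' s') pi ->
    reach n q' s' (Kof (stay q' s') pi) <= 0.
  elim: n q' s' pi => [|n IH] q' s' pi F hp ge; have [lq V0] := FNlive _ _ F.
    by rewrite reach0.
  have Gm := Gd q' s' pi hp.
  have m0 : forall t, 0 <= pi [::] (d (q', s')) t by case: Gm => -[].
  move: ge; rewrite Rch_step// -/(Kof _ _ _) Kst => ge.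
  have [le cases] := hd (q', s') F _ Gm.
  have eqR t : 0 < pi [::] (d (q', s')) t ->
      VN (nx q') t <= Rch (nx q') t (after (stay q' s') t) (after pi t).
    move=> mt; rewrite leNgt; apply/negP => lt.
    have := le_lt_trans ge (dot_lt m0 (fun t => c1' q' s' pi t F hp) mt lt).
    by rewrite ltNge le.
  have nP t : 0 < pi [::] (d (q', s')) t -> ~ P (nx q') t.
    move=> mt Pt; have := eqR t mt; rewrite stayP//.
    case: (hwin (nx q', t)) => /= hs /(_ Pt _ (natr_after t hp)).
    by rewrite ltNge => /negP.
  have Ft t : 0 < pi [::] (d (q', s')) t -> FN P (nx q') t.
    case: cases => [lt|[t' [mt' Pt']]|]; [|by case: (nP t')|exact].
    have := le_trans ge (dot_le m0 (fun t => c1' q' s' pi t F hp)).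
    by rewrite leNgt lt.
  rewrite reach_live// Kst.
  apply: (@le_trans _ _ (dot (pi [::] (d (q', s'))) (fun=> 0))); last first.
    by rewrite dot_cst//; case: Gm.
  apply: dot_le => // t mt; have := eqR t mt.
  rewrite after_Kof.
  rewrite stayF//; [|exact: nP|exact: Ft].
  by apply: IH; [exact: Ft|exact: natr_after hp].
move=> B; apply: (B P) => {B}q {}s F; exists (stay q s); split=> // pi hp.
rewrite ltNge; apply/negP => ge; have [_] := FNlive _ _ F.
rewrite ltNge => /negP; apply; apply: (le_trans ge).
by apply: Reach_le => n; exact: c2.
Qed.

(* Every state outside BN reaches, with probability at least eta ^+ J, a point
   where nature has nothing left to lose, so a bound on the deficit
   [VN - Reach] shrinks by the factor 1 - eta ^+ J. *)
Lemma BN_natr q s sg : ~ BN q s -> sched sg ->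
  exists pi, natr s pi /\ VN q s <= Rch q s sg pi.
Proof.
have /choice[m0 hm0] (x : Q * S * A) : exists mu, let: (q, s, a) := x in
    Gamma I s a mu /\ forall k, ZN BN k.+1 q s -> ~ ZN BN k q s -> live q s ->
      0 < VN q s -> TN BN (ZN BN k) q (VN q s) mu.
  case: x => [[q' s'] a].
  have [[k [Zk nZk lq V0]]|n] := pselect (exists k, [/\ ZN BN k.+1 q' s',
      ~ ZN BN k q' s', live q' s' & 0 < VN q' s']).
    case: (Zk) => [/negP//|le|/(_ a)[mu [Gm T]]]; first by move: V0; rewrite ltNge le.
    exists mu; split=> // l Zl nZl _ _.
    (* [k.+1] is the rank of the pair, the first stage that contains it. As stages grow, the rank is
       unique and one answer suffices. *)
    suff -> : l = k by [].
    by case: (ltngtP l k) => // lk; [case: nZk; exact: ZN_le Zl|case: nZl; exact: ZN_le Zk].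
  have [mu Gm] := Gamma_ex s' a; exists mu; split=> // k h1 h2 h3 h4.
  by case: n; exists k.
pose m q s a := m0 (q, s, a).
have hm q' s' a : Gamma I s' a (m q' s' a) by case: (hm0 (q', s', a)).
have hmT q' s' a k : ZN BN k.+1 q' s' -> ~ ZN BN k q' s' -> live q' s' ->
    0 < VN q' s' -> TN BN (ZN BN k) q' (VN q' s') (m q' s' a).
  by case: (hm0 (q', s', a)) => _; exact.
have md q' s' a : is_dist (m q' s' a) by case: (hm q' s' a).
(* A lower bound on the positive transition probabilities of the finitely many chosen answers,
   capped at 1 so that its powers decrease. *)
have [eta [eta0 eta1 heta]] : exists eta : R, [/\ 0 < eta, eta <= 1 &
    forall q s a t, 0 < m q s a t -> eta <= m q s a t].
  have [e [e0 he]] : exists e : R, 0 < e /\ forall x : Q * S * A * S,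
      0 < m0 x.1 x.2 -> e <= m0 x.1 x.2.
    apply: fin_uniform_pos => [x e e' ee' h /h|x]; first exact: le_trans.
    have [gt|ngt] := pselect (0 < m0 x.1 x.2); last by exists 1.
    by exists (m0 x.1 x.2).
  exists (Num.min e 1); split; first by rewrite lt_min e0 ltr01.
    by rewrite ge_min lexx orbT.
  by move=> q' s' a t /(he (q', s', a, t)) le; rewrite ge_min le.
have /choice[sp hsp] (x : Q * S * R) : exists pi, let: (q, s, e) := x in natr s pi /\
    (0 < e -> forall sg, sched sg -> VN q s - e <= Rch q s sg pi).
  case: x => [[q' s'] e]; have [e0|ne] := pselect (0 < e).
    by have [pi [h1 h2]] := approxN q' s' e0; exists pi.
  by have [pi [h1 h2]] := approxN q' s' ltr01; exists pi; split=> // /ne.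
(* When the mixture strictly raises the value, the gain pays for the error of a near-optimal
   continuation given by [approxN]. *)
pose gain q s rho := dot (mix rho (m q s)) (VN (nx q)) - VN q s.
pose alt q s rho s' := sp (nx q, s', gain q s rho).
have halt q' s' rho t : natr t (alt q' s' rho t).
  by case: (hsp (nx q', t, gain q' s' rho)).
pose sw q s rho := 0 < gain q s rho.
pose pi := follow m sw alt.
have hpi q' s' sg' : natr s' (pi q' s' sg') by exact: natr_follow.
pose def q s sg := VN q s - Rch q s sg (pi q s sg).
pose bounded e := forall q s sg, ~ BN q s -> sched sg -> def q s sg <= e.
have shrink e k q' s' sg' : 0 <= e -> bounded e -> ZN BN k q' s' -> sched sg' ->
    def q' s' sg' <= (1 - eta ^+ k) * e.
  move=> e0 be; elim: k q' s' sg' => [//|k IH] q' s' sg' Z hs.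
  have ek0 : 0 <= eta ^+ k by rewrite exprn_ge0// ltW.
  have ek1 : eta ^+ k <= 1 by rewrite exprn_ile1// ltW.
  have eS : eta ^+ k.+1 <= eta ^+ k by rewrite exprS ler_piMl.
  have rhs0 : 0 <= (1 - eta ^+ k.+1) * e.
    by rewrite mulr_ge0// subr_ge0 (le_trans eS).
  have kK : stochastic (Kof sg' (pi q' s' sg')) by exact: stochastic_Kof (hpi _ _ _).
  have [Zk|nZk] := pselect (ZN BN k q' s').
    apply: le_trans (IH _ _ _ Zk hs) _; apply: ler_wpM2r => //; lra.
  case: (statusP G D q' s') => [Gq|nG nD|lq].
  - by rewrite /def Reach_G// VN_G// subrr.
  - apply: le_trans rhs0; rewrite /def VN_dead// subr_le0; exact: Reach_ge0.
  have [V0|V0] := ltP 0 (VN q' s'); last first.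
    apply: le_trans rhs0; rewrite /def subr_le0 (le_trans V0)//; exact: Reach_ge0.
  have T a := hmT q' s' a k Z nZk lq V0.
  have mixd := is_dist_mix (hs [::]) (md q' s').
  have ge a : VN q' s' <= dot (m q' s' a) (VN (nx q')) by case: (T a) => [/ltW//|[]].
  rewrite /def Rch_step//.
  rewrite (_ : dot _ _ = dot (mix (sg' [::]) (m q' s')) (fun t =>
      Rch (nx q') t (after sg' t)
        (if sw q' s' (sg' [::]) then alt q' s' (sg' [::]) t
         else pi (nx q') t (after sg' t)))); last first.
    by congr dot; apply/funext => t; rewrite -after_follow.
  case: (boolP (sw q' s' (sg' [::]))) => [sw1|].
    apply: le_trans rhs0; rewrite subr_le0.
    apply: (@le_trans _ _ (dot (mix (sg' [::]) (m q' s'))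
      (fun t => VN (nx q') t + - gain q' s' (sg' [::])))).
      by rewrite dotDc// /gain opprB addrC subrK.
    apply: dot_le => [|t _]; first by case: mixd.
    case: (hsp (nx q', t, gain q' s' (sg' [::]))) => _; apply=> //.
    exact: sched_after.
  rewrite /sw -leNgt subr_le0 => gele.
  apply: (@le_trans _ _ (dot (mix (sg' [::]) (m q' s')) (fun t =>
      def (nx q') t (after sg' t)))).
    by rewrite dotB lerD2r; exact: mix_dot_ge.
  apply: mix_dot_le => // a ra.
  have [s1 [m1 Z1]] : exists t, 0 < m q' s' a t /\ ZN BN k (nx q') t.
    case: (T a) => [gt|[_ _ [t [mt Zt]]]]; last by exists t.
    by move: gele; rewrite leNgt (mix_dot_gt (hs [::]) (fun b _ => ge b) ra gt).
  have nB t : 0 < m q' s' a t -> ~ BN (nx q') t.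
    case: (T a) => [gt|[_ + _]]; last by apply.
    by move: gele; rewrite leNgt (mix_dot_gt (hs [::]) (fun b _ => ge b) ra gt).
  (* The successor [s1] lies in the previous stage, so its deficit is at most (1 - eta ^+ k) * e,
     and its weight is at least [eta]. Other successors stay outside [BN] and have deficit at most
     e. *)
  apply: (@le_trans _ _ (dot (m q' s' a) (fun t => e - (t == s1)%:R * (eta ^+ k * e)))).
    apply: dot_le => [|t mt]; first by case: (md q' s' a).
    have [->|_] := eqVneq t s1.
      by have := IH _ _ _ Z1 (sched_after s1 hs); rewrite mulrBl mul1r /= mulr1n mul1r.
    by rewrite /= mulr0n mul0r subr0; apply: be (sched_after t hs); exact: nB.
  rewrite dotB dot_cst// mulrBl mul1r lerB// /dot (bigD1 s1)//= eqxx mul1r.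
  rewrite big1 ?addr0; last by move=> t /negbTE->; rewrite mul0r mulr0.
  by rewrite exprS -mulrA ler_wpM2r ?mulr_ge0// heta.
have [J hJ] : exists J, forall x : Q * S, ~ BN x.1 x.2 -> ZN BN J x.1 x.2.
  apply: fin_uniform_nat => [x k l kl h /h|x]; first exact: ZN_le.
  have [B|nB] := pselect (BN x.1 x.2); first by exists 0%N.
  have : ~ FN BN x.1 x.2 by move=> h; apply: nB; exact: (lfp_fold FN_mono).
  by move=> /existsNP[k /contrapT Zk]; exists k.
have eJ : 0 <= 1 - eta ^+ J < 1.
  by rewrite subr_ge0 exprn_ile1// ?(ltW eta0)//= ltrBlDr ltrDl exprn_gt0.
have bn n : bounded ((1 - eta ^+ J) ^+ n).
  elim: n => [|n IH] q' s' sg' nB hs.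
    rewrite expr0 /def; have := VN_le1 q' s'.
    have := Reach_ge0 nx G D q' s' (stochastic_Kof hs (hpi q' s' sg')); lra.
  rewrite exprS; apply: shrink => //; last exact: (hJ (q', s')).
  by rewrite exprn_ge0//; case/andP: eJ.
move=> nB hs; exists (pi q s sg); split=> //; apply: le_of_eps => e e0.
have [n ne] := pow_small eJ e0.
have := bn n q s sg nB hs; rewrite /def; lra.
Qed.

End StrictMin.

(** * Winning conditions for the four comparisons *)

Definition wins (c : cmp) (p : R) q s := exists sg, sched sg /\
  forall pi, natr s pi -> cmp_sem c (Rch q s sg pi)%:E p%:E.

Lemma wins_ge p q s : wins CGe p q s <-> p <= VS q s.
Proof.
split=> [[sg [hs h]]|le].
  apply: le_of_eps => e e0; have [pi [hp hle]] := spoilS q s e0.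
  by have := h pi hp; rewrite /= lee_fin => /le_trans; apply; exact: hle.
have [opt /(_ q s)[hs h]] := optS.
by exists (opt q s); split=> // pi /h; rewrite /= lee_fin; exact: le_trans.
Qed.

Lemma wins_gt p q s : wins CGt p q s <-> p < VS q s \/ (p = VS q s /\ BS q s).
Proof.
split=> [[sg [hs h]]|[lt|[-> /BS_sched[sg [hs h]]]]].
- have : p <= VS q s.
    apply/wins_ge; exists sg; split=> // pi /h.
    by rewrite /= lte_fin lee_fin; exact: ltW.
  rewrite le_eqVlt => /predU1P[pE|]; [right; split=> //|by left].
  apply: contrapT => nB; have [pi [hp hle]] := BS_natr nB hs.
  by have := h pi hp; rewrite /= lte_fin pE ltNge hle.
- have [opt /(_ q s)[hs h]] := optS.
  by exists (opt q s); split=> // pi /h; rewrite /= lte_fin; exact: lt_le_trans.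
- by exists sg; split=> // pi /h; rewrite /= lte_fin.
Qed.

Lemma wins_le p q s : wins CLe p q s <-> VN q s <= p.
Proof.
split=> [[sg [hs h]]|le].
  apply: le_of_eps => e e0; have [pi [hp /(_ sg hs) hle]] := approxN q s e0.
  by have := h pi hp; rewrite /= lee_fin; lra.
have [opt /(_ q s)[hs h]] := optN.
by exists (opt q s); split=> // pi /h /le_trans; rewrite /= lee_fin; apply.
Qed.

Lemma wins_lt p q s : wins CLt p q s <-> VN q s < p \/ (VN q s = p /\ BN q s).
Proof.
split=> [[sg [hs h]]|[lt|[<- /BN_sched[sg [hs h]]]]].
- have : VN q s <= p.
    apply/wins_le; exists sg; split=> // pi /h.
    by rewrite /= lte_fin lee_fin; exact: ltW.
  rewrite le_eqVlt => /predU1P[pE|]; [right; split=> //|by left].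
  apply: contrapT => nB; have [pi [hp hle]] := BN_natr nB hs.
  by have := h pi hp; rewrite /= lte_fin -pE ltNge hle.
- have [opt /(_ q s)[hs h]] := optN.
  by exists (opt q s); split=> // pi /h /le_lt_trans; rewrite /= lte_fin; apply.
- by exists sg; split=> // pi /h; rewrite /= lte_fin.
Qed.

Lemma wins_inv c p q s t : Rl s t -> wins c p q s <-> wins c p q t.
Proof.
move=> st; case: c.
- by rewrite !wins_le (VN_inv q st).
- by rewrite !wins_lt (VN_inv q st) (BN_inv q st).
- by rewrite !wins_ge (VS_inv q st).
- by rewrite !wins_gt (VS_inv q st) (BS_inv q st).
Qed.

End Game.

(** * Path events have the probabilities computed by [Reach] *)

Section PathMeasure.
Variables (R : realType) (S : finType) (s0 : S).

Definition Cyl (w : Defs.fpath S) : set (paths s0) := cyl w.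

Lemma measurable_cyl (w : Defs.fpath S) : measurable (Cyl w).
Proof. by apply: sub_sigma_algebra; exists w. Qed.

Lemma cyl_extE (w : Defs.fpath S) (om : ipath s0) (t : S) :
  Cyl (fp_ext w t) om <-> Cyl w om /\ om (size w.2).+1 = t.
Proof.
case: w => x u; rewrite /Cyl /cyl /fp_states /fp_ext /=; split=> [h|[h e] i].
  split=> [i iu|]; last first.
    rewrite h ?size_rcons//= nth_rcons ltnn eqxx//.
  rewrite h; last by rewrite size_rcons ltnW.
  case: i iu => [//|i] /=; rewrite ltnS => iu; by rewrite nth_rcons iu.
rewrite size_rcons ltnS leq_eqVlt => /predU1P[->|iu].
  by rewrite e /= nth_rcons ltnn eqxx.
rewrite h//; case: i iu => [//|i] /=; rewrite ltnS => iu; by rewrite nth_rcons iu.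
Qed.

Lemma cyl_last (w : Defs.fpath S) (om : ipath s0) : Cyl w om -> om (size w.2) = fp_last w.
Proof.
case: w => x u /(_ (size u)) /= -> //.
by rewrite /fp_last /= (last_nth x).
Qed.

Section Hits.
Variables (Q : finType) (nx : Q -> Q) (G D : Q -> S -> bool).

Definition event q : set (paths s0) := [set om : paths s0 | exists i,
  G (iter i nx q) (om i) /\ forall j, (j < i)%N -> D (iter j nx q) (om j)].

(** The recursion on the horizon mirrors that of [reach], so that the two unfold together; [k] is
    the position from which the path is read. *)
Fixpoint hits n q k (om : nat -> S) : bool :=
  G q (om k) || D q (om k) && (if n is n'.+1 then hits n' (nx q) k.+1 om else false).

Lemma hitsP n q k (om : nat -> S) : hits n q k om <-> exists i, [/\ (i <= n)%N,
  G (iter i nx q) (om (k + i)%N) &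
  forall j, (j < i)%N -> D (iter j nx q) (om (k + j)%N)].
Proof.
elim: n q k => [|n IH] q k /=.
  rewrite andbF orbF; split=> [h|[[|i]]]; first by exists 0%N; rewrite addn0.
    by rewrite addn0 => -[].
  by case.
split=> [/orP[h|/andP[h /IH[i [le h1 h2]]]]|[[|i] [le h1 h2]]].
- by exists 0%N; rewrite addn0.
- exists i.+1; rewrite iterSr addnS -addSn; split=> // -[_|j].
    by rewrite addn0.
  by rewrite ltnS iterSr addnS -addSn; exact: h2.
- by rewrite -[k]addn0 h1.
have := h2 0%N; rewrite addn0 /= => -> //; apply/orP; right.
apply/IH; exists i; split=> //.
  by rewrite -iterSr addSn -addnS.
by move=> j ji; rewrite -iterSr addSn -addnS; exact: h2.
Qed.

Lemma eventE q : event q = \bigcup_n [set om : paths s0 | hits n q 0 om].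
Proof.
apply/seteqP; split=> om /=.
  by move=> [i [h1 h2]]; exists i => //=; apply/hitsP; exists i.
by move=> [n _ /= /hitsP[i [_ h1 h2]]]; exists i.
Qed.

Lemma cyl_hits_live n q w : live G D q (fp_last w) ->
  Cyl w `&` [set om : paths s0 | hits n.+1 q (size w.2) om] =
  \bigcup_(t in [set: S])
    (Cyl (fp_ext w t) `&` [set om : paths s0 | hits n (nx q) (size w.2).+1 om]).
Proof.
move=> /andP[/negbTE nG Dq]; apply/seteqP; split=> om /=.
  move=> [cw]; rewrite (cyl_last cw) nG Dq/= => h.
  by exists (om (size w.2).+1) => //; split=> //; exact/cyl_extE.
move=> [t _ [/cyl_extE[cw _] h]]; split=> //.
by rewrite (cyl_last cw) nG Dq.
Qed.

Lemma cyl_hits_G n q w : G q (fp_last w) ->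
  Cyl w `&` [set om : paths s0 | hits n q (size w.2) om] = Cyl w.
Proof.
move=> Gq; apply/seteqP; split=> om /=; [by case|move=> cw; split=> //].
by case: n => [|n] /=; rewrite (cyl_last cw) Gq.
Qed.

Lemma cyl_hits_dead n q w : ~~ G q (fp_last w) -> ~~ D q (fp_last w) ->
  Cyl w `&` [set om : paths s0 | hits n q (size w.2) om] = set0.
Proof.
move=> /negbTE nG /negbTE nD; apply/seteqP; split=> om //= [cw].
by case: n => [|n] /=; rewrite (cyl_last cw) nG nD.
Qed.

Lemma cyl_hits0 q w : live G D q (fp_last w) ->
  Cyl w `&` [set om : paths s0 | hits 0 q (size w.2) om] = set0.
Proof.
move=> /andP[/negbTE nG Dq]; apply/seteqP; split=> om //= [cw].
by rewrite (cyl_last cw) nG andbF.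
Qed.

Lemma measurable_cyl_hits n q w :
  measurable (Cyl w `&` [set om : paths s0 | hits n q (size w.2) om]).
Proof.
elim: n q w => [|n IH] q w; case: (statusP G D q (fp_last w)) => [h|h h'|h].
- by rewrite cyl_hits_G//; exact: measurable_cyl.
- by rewrite cyl_hits_dead.
- by rewrite cyl_hits0.
- by rewrite cyl_hits_G//; exact: measurable_cyl.
- by rewrite cyl_hits_dead.
rewrite cyl_hits_live//; apply: fin_bigcup_measurable; first exact: finite_finset.
by move=> t _; have := IH (nx q) (fp_ext w t); rewrite /fp_ext /= size_rcons.
Qed.

Lemma measurable_hits n q : measurable [set om : paths s0 | hits n q 0 om].
Proof.
rewrite (_ : [set _ | _] = \bigcup_(t in [set: S])
    (Cyl (t, [::]) `&` [set om : paths s0 | hits n q 0 om])).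
  apply: fin_bigcup_measurable; first exact: finite_finset.
  by move=> t _; exact: (measurable_cyl_hits n q (t, [::])).
apply/seteqP; split=> om /=; last by move=> [t _ []].
by move=> h; exists (om 0%N) => //; split=> // -[|i].
Qed.

Variables (P : probability (paths s0) R) (K : seq S -> S -> R).
Hypothesis K_dist : stochastic K.
Hypothesis P_start : P (Cyl (s0, [::])) = 1%E.
Hypothesis P_step : forall u t,
  P (Cyl (s0, rcons u t)) = (P (Cyl (s0, u)) * (K u t)%:E)%E.

(** Conditioned on the prefix [u], the kernel is its residual after [u]. In a live state the event
    splits over the disjoint one-state extensions of the cylinder. *)
Lemma Pr_cyl_hits n q u :
  P (Cyl (s0, u) `&` [set om : paths s0 | hits n q (size u) om]) =
  (P (Cyl (s0, u)) * (reach nx G D n q (last s0 u) (fun v => K (u ++ v)))%:E)%E.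
Proof.
elim: n q u => [|n IH] q u; case: (statusP G D q (last s0 u)) => [h|h h'|h].
- by rewrite (cyl_hits_G 0 (w := (s0, u)))// reach_G// mule1.
- by rewrite (cyl_hits_dead 0 (w := (s0, u)))// reach_dead// measure0 mule0.
- by rewrite (cyl_hits0 (w := (s0, u)))// reach0// measure0 mule0.
- by rewrite (cyl_hits_G n.+1 (w := (s0, u)))// reach_G// mule1.
- by rewrite (cyl_hits_dead n.+1 (w := (s0, u)))// reach_dead// measure0 mule0.
rewrite (cyl_hits_live n (w := (s0, u)))// measure_fin_bigcup//; last 3 first.
- exact: finite_finset.
- apply/trivIsetP => t t' _ _ /eqP tt'; apply/seteqP; split=> om //=.
  by move=> [[/cyl_extE[_ e] _] [/cyl_extE[_ e'] _]]; apply: tt'; rewrite -e -e'.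
- move=> t _; have := measurable_cyl_hits n (nx q) (s0, rcons u t).
  by rewrite /= size_rcons.
have -> : [set: S] = [set` enum S].
  by apply/seteqP; split=> t //= _; rewrite mem_enum.
rewrite reach_live// -fsbig_seq ?enum_uniq// big_enum.
transitivity (\sum_(t : S) P (Cyl (s0, u)) *
    (K u t * reach nx G D n (nx q) t (fun v => K (rcons u t ++ v)))%:E)%E.
  apply: eq_bigr => t _; have := IH (nx q) (rcons u t).
  by rewrite size_rcons last_rcons P_step -muleA -EFinM.
have fP : P (Cyl (s0, u)) \is a fin_num by apply: fin_num_measure; exact: measurable_cyl.
rewrite -(fineK fP) -ge0_sume_distrr//; last first.
  move=> t _; rewrite lee_fin mulr_ge0//; first by case: (K_dist u).
  by apply: reach_ge0 => v; exact: K_dist.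
rewrite sumEFin; congr (_ * _%:E)%E; rewrite cats0.
apply: eq_bigr => t _; congr (_ * reach _ _ _ _ _ _ _).
by apply/funext => v; rewrite cat_rcons.
Qed.

Lemma Pr_hits n q : P [set om : paths s0 | hits n q 0 om] = (reach nx G D n q s0 K)%:E.
Proof.
have := Pr_cyl_hits n q [::]; rewrite P_start mul1e /= => <-.
have mH := measurable_hits n q.
have mC := measurable_cyl (s0, [::]).
(* Paths that do not start in [s0] form a null set. *)
rewrite (measureDI P mH mC) [X in (X + _)%E](_ : _ = 0)%E ?add0e 1?setIC//.
have PC : P (~` Cyl (s0, [::])) = 0%E by rewrite probability_setC// P_start subee.
apply: (subset_measure0 (B := ~` Cyl (s0, [::]))) => //.
- exact: measurableD.
- exact: measurableC.
Qed.

Lemma Pr_event q : P (event q) = (Reach nx G D q s0 K)%:E.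
Proof.
rewrite eventE.
have h1 : P [set om : paths s0 | hits n q 0 om] @[n --> \oo] -->
    P (\bigcup_n [set om : paths s0 | hits n q 0 om]).
  apply: nondecreasing_cvg_mu.
  - by move=> n; exact: measurable_hits.
  - by apply: bigcupT_measurable => n; exact: measurable_hits.
  move=> m n mn; apply/subsetPset => om /= /hitsP[i [le h1 h2]].
  by apply/hitsP; exists i; split=> //; exact: leq_trans mn.
have h2 : P [set om : paths s0 | hits n q 0 om] @[n --> \oo] -->
    (Reach nx G D q s0 K)%:E.
  under eq_cvg do rewrite Pr_hits.
  by apply: cvg_EFin; [exact: nearW|exact: reach_cvg].
exact: cvg_unique h1 h2.
Qed.

End Hits.

End PathMeasure.

(** * Digit expansions of the unit interval along a kernel *)

Section Cells.
Variables (R : realType) (S : finType).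
Implicit Types (k : S -> R) (r : seq S) (K : seq S -> S -> R).

(** Left end of the interval of length [k s] assigned to [s] when consecutive intervals are laid out
    from 0 in the order of [r]. *)
Fixpoint cum k r (s : S) : R :=
  if r is t :: r' then (if t == s then 0 else k t + cum k r' s) else 0.

Lemma cum_ge0 k r s : (forall t, 0 <= k t) -> 0 <= cum k r s.
Proof.
by move=> k0; elim: r => //= t r IH; case: ifP => // _; rewrite addr_ge0.
Qed.

Lemma cum_le k r s : (forall t, 0 <= k t) -> s \in r ->
  cum k r s + k s <= \sum_(t <- r) k t.
Proof.
move=> k0; elim: r => //= t r IH; rewrite inE big_cons eq_sym.
case: eqVneq => [->|_] /= sr; first by rewrite add0r lerDl sumr_ge0.
by rewrite -addrA lerD2l IH.
Qed.

Lemma cum_ex k r x : (forall t, 0 <= k t) -> 0 <= x < \sum_(t <- r) k t ->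
  uniq r -> exists2 s, s \in r & cum k r s <= x < cum k r s + k s.
Proof.
move=> k0; elim: r x => [|t r IH] x; first by rewrite big_nil => /andP[]; lra.
rewrite big_cons /= => /andP[x0 xl] /andP[tr ur].
have [xt|tx] := ltP x (k t).
  by exists t; rewrite ?mem_head// eqxx x0 add0r.
have [|s sr h] := IH (x - k t) _ ur; first by apply/andP; split; lra.
exists s; first by rewrite inE sr orbT.
case: eqVneq => [ts|_]; first by move: tr; rewrite ts sr.
by move/andP: h => [h1 h2]; apply/andP; split; lra.
Qed.

Lemma cum_uniq k r x s s' : (forall t, 0 <= k t) -> s \in r -> s' \in r ->
  cum k r s <= x < cum k r s + k s -> cum k r s' <= x < cum k r s' + k s' -> s = s'.
Proof.
move=> k0; elim: r x => //= t r IH x; rewrite !inE !(eq_sym _ t).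
have h u := cum_ge0 r u k0.
case: eqVneq => [<-|_] /=; case: eqVneq => [<-|_] //=.
- by move=> _ _ /andP[? ?] /andP[? ?]; exfalso; have := h s'; lra.
- by move=> _ _ /andP[? ?] /andP[? ?]; exfalso; have := h s; lra.
move=> sr s'r /andP[? ?] /andP[? ?]; apply: (IH (x - k t)) => //;
  by apply/andP; split; lra.
Qed.

(* The sub-interval of [0, 1[ of points whose digit expansion starts with u,
   given by its left end and its length. *)
Fixpoint cell K (u : seq S) : R * R :=
  if u is s :: u' then
    let c := cell (after K s) u' in
    (cum (K [::]) (enum S) s + K [::] s * c.1, K [::] s * c.2)
  else (0, 1).

Definition digit K (s0 : S) (x : R) : S :=
  odflt s0 [pick s | cum (K [::]) (enum S) s <= x
                     < cum (K [::]) (enum S) s + K [::] s].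

(** The quotient stretches the interval of the first digit onto [0, 1[, where the residual kernel
    reads the next digit. *)
Fixpoint expansion n K (s0 : S) (x : R) : S :=
  let s := digit K s0 x in
  if n is n'.+1 then
    expansion n' (after K s) s0 ((x - cum (K [::]) (enum S) s) / K [::] s)
  else s.

Lemma digitP K s0 x s : stochastic K -> 0 <= x < 1 ->
  digit K s0 x = s <-> cum (K [::]) (enum S) s <= x < cum (K [::]) (enum S) s + K [::] s.
Proof.
move=> kK x01; have [k0 k1] := kK [::].
have [s1 _ h1] : exists2 s, s \in enum S &
    cum (K [::]) (enum S) s <= x < cum (K [::]) (enum S) s + K [::] s.
  by apply: cum_ex; rewrite ?enum_uniq// big_enum k1.
rewrite /digit; case: pickP => [s2 h2|/(_ s1)]; last by rewrite h1.
split=> [/= <-//|h]; apply: cum_uniq h2 h => //; exact: mem_enum.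
Qed.

Lemma cell_bounds K u : stochastic K ->
  [/\ 0 <= (cell K u).1, 0 <= (cell K u).2 & (cell K u).1 + (cell K u).2 <= 1].
Proof.
elim: u K => [|s u IH] K kK /=; first by split; lra.
have [h1 h2 h3] := IH _ (stochastic_after s kK).
have [k0 k1] := kK [::].
have c0 := cum_ge0 (enum S) s k0.
have c1 : cum (K [::]) (enum S) s + K [::] s <= 1.
  have := @cum_le (K [::]) (enum S) s k0 (mem_enum _ s).
  by rewrite big_enum k1.
have := k0 s => ks; split; [by rewrite addr_ge0// mulr_ge0|by rewrite mulr_ge0|nra].
Qed.

(** The rescaling to [x'] carries the cell of [s :: u] onto the cell of [u] for the residual kernel.
    Half-open cells make the equivalence exact at the end points and exclude digits of weight
    zero. *)
Lemma expansionP K s0 u x : stochastic K -> 0 <= x < 1 ->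
  (forall i, (i < size u)%N -> expansion i K s0 x = nth s0 u i) <->
  (cell K u).1 <= x < (cell K u).1 + (cell K u).2.
Proof.
elim: u K x => [|s u IH] K x kK x01; first by rewrite /= add0r x01.
have [k0 k1] := kK [::].
pose c := cum (K [::]) (enum S) s; pose x' := (x - c) / K [::] s.
have [b1 b2 b3] := cell_bounds u (stochastic_after s kK).
have IH' := IH _ x' (stochastic_after s kK).
have split_x : 0 < K [::] s -> x = c + K [::] s * x'.
  by move=> ks; rewrite /x' mulrC divfK ?gt_eqF// addrC subrK.
have in01 : c <= x < c + K [::] s -> 0 < K [::] s /\ 0 <= x' < 1.
  move=> /andP[h1 h2]; have ks : 0 < K [::] s by lra.
  by split=> //; rewrite /x' divr_ge0 ?subr_ge0 ?(ltW ks)//= ltr_pdivrMr//; lra.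
split=> [h|/= /andP[h1 h2]].
  have d : digit K s0 x = s by exact: (h 0%N).
  have /(digitP s0 s kK x01) hc := d.
  have [ks x'01] := in01 hc.
  have /(IH' x'01) /andP[g1 g2] : forall i, (i < size u)%N ->
      expansion i (after K s) s0 x' = nth s0 u i.
    by move=> i iu; have := h i.+1 iu; rewrite /= d.
  by rewrite /= -/c (split_x ks); apply/andP; split; nra.
have hc : c <= x < c + K [::] s.
  by have := k0 s => ks; rewrite -/c in h1 h2; apply/andP; split; nra.
have [ks x'01] := in01 hc.
have /(digitP s0 s kK x01) d := hc.
rewrite -/c in h1 h2.
have hx' : (cell (after K s) u).1 <= x' < (cell (after K s) u).1 + (cell (after K s) u).2.
  by rewrite /x' ler_pdivlMr// ltr_pdivrMr//; apply/andP; split; nra.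
case=> [_|i iu] /=; rewrite d//.
by have /IH' := hx'; exact.
Qed.

Lemma cell_rcons K u t : (cell K (rcons u t)).2 = (cell K u).2 * K u t.
Proof.
elim: u K => [|s u IH] K /=; first by rewrite mulr1 mul1r.
by rewrite IH mulrA.
Qed.

End Cells.

(** * Existence of path measures as images of Lebesgue measure *)

Section PathMeasureExistence.
Variables (R : realType) (S : finType) (s0 : S) (K : seq S -> S -> R).
Hypothesis K_dist : stochastic K.

Let unit_itv : set (measurableTypeR R) := [set` `[0, 1[%R].

Definition path_of (x : measurableTypeR R) : paths s0 :=
  fun i => if i is j.+1 then expansion j K s0 x else s0.

Lemma path_of_cyl w : unit_itv `&` path_of @^-1` @Cyl S s0 w =
  if w.1 == s0 then
    [set` `[(cell K w.2).1, (cell K w.2).1 + (cell K w.2).2[%R] : set R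
  else set0.
Proof.
case: w => [s u] /=; case: eqVneq => [->|ne]; apply/seteqP; split=> x //=.
- rewrite /unit_itv /= !in_itv/= => -[x01 h].
  by apply/(expansionP s0 u K_dist x01) => i iu; exact: (h i.+1).
- have [b1 b2 b3] := cell_bounds u K_dist.
  rewrite in_itv /= => hx.
  have x01 : 0 <= x < 1 by move/andP: hx => [? ?]; apply/andP; split; lra.
  split; first by rewrite /unit_itv /= in_itv.
  move=> [//|i] iu; exact: (proj2 (expansionP s0 u K_dist x01) hx).
- by move=> [_ /(_ 0%N isT)] /= e; move: ne; rewrite -e eqxx.
Qed.

Lemma measurable_path_of : measurable_fun unit_itv path_of.
Proof.
apply: (@measurability _ _ (measurableTypeR R) (paths s0) unit_itv path_of
  (@cylinders S s0)) => // _ [_ [w ->] <-].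
by rewrite -/(@Cyl S s0 w) path_of_cyl; case: ifP.
Qed.

Definition path_measure (A : set (paths s0)) : \bar R :=
  lebesgue_measure (unit_itv `&` path_of @^-1` A).

Let mpre A : measurable A -> measurable (unit_itv `&` path_of @^-1` A).
Proof. by move=> mA; exact: (measurable_path_of (measurable_itv _) mA). Qed.

Let path_measure0 : path_measure set0 = 0%E.
Proof. by rewrite /path_measure preimage_set0 setI0 measure0. Qed.

Let path_measure_ge0 A : (0 <= path_measure A)%E.
Proof. exact: measure_ge0. Qed.

Let path_measure_sigma_additive : semi_sigma_additive path_measure.
Proof.
move=> F mF tF mUF; rewrite /path_measure preimage_bigcup setI_bigcupr.
apply: measure_semi_sigma_additive => [n||].
- exact: mpre.
- apply/trivIsetP => /= i j _ _ ij; apply/seteqP; split=> x //= -[[_ h1] [_ h2]].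
  have : (F i `&` F j) (path_of x) by [].
  by move/trivIsetP : tF => /(_ i j I I ij) ->.
- by rewrite -setI_bigcupr -preimage_bigcup; exact: mpre.
Qed.

HB.instance Definition _ := isMeasure.Build _ _ _ path_measure
  path_measure0 path_measure_ge0 path_measure_sigma_additive.

Let path_measureT : path_measure setT = 1%E.
Proof.
rewrite /path_measure preimage_setT setIT /unit_itv lebesgue_measure_itv/=.
by rewrite lte_fin ltr01 oppr0 adde0.
Qed.

HB.instance Definition _ := Measure_isProbability.Build _ _ _ path_measure
  path_measureT.

Definition path_probability : probability (paths s0) R := path_measure.

Lemma path_probability_cyl w : path_probability (@Cyl S s0 w) =
  (if w.1 == s0 then (cell K w.2).2 else 0)%:E.
Proof.
rewrite /= /path_measure path_of_cyl; case: ifP => _; last by rewrite measure0.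
have [b1 b2 b3] := cell_bounds w.2 K_dist.
rewrite lebesgue_measure_itv/= lte_fin ltrDl.
case: ifPn => [_|]; first by rewrite -EFinB addrAC subrr add0r.
by rewrite -leNgt => b2'; congr EFin; apply/eqP; rewrite eq_le b2.
Qed.

End PathMeasureExistence.

(** * From satisfaction to games, and induction on formulas *)

Section Soundness.
Variables (R : realType) (S A AP : finType) (I : S -> A -> S -> interval R).
Variable L : S -> {set AP}.
Hypothesis Gamma_ex : forall s a, exists mu, Gamma I s a mu.

(** Only paths starting in [s] matter, so strategies are exchanged by fixing or forgetting the first
    state. From satisfaction to the game a measure must be exhibited, since satisfaction speaks of
    every measure with the given cylinder probabilities. *)
Lemma sat_prob_wins (Q : finType) (nx : Q -> Q) (G D : Q -> S -> bool) (q0 : Q)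
    c p psi s :
  (forall om, psat L I psi om <-> exists i, G (iter i nx q0) (om i) /\
     forall j, (j < i)%N -> D (iter j nx q0) (om j)) ->
  sat L I (SProb c p psi) s <-> wins I nx G D c (ratr p) q0 s.
Proof.
move=> psiE.
have evE : [set om : paths s | psat L I psi om] = @event S s Q nx G D q0.
  by apply/seteqP; split=> om /= /psiE.
rewrite /= evE; split=> [[sigma [hs h]]|[sg [hs h]]].
  exists (fun u => sigma (s, u)); split=> [u|pi hp]; first exact: hs.
  have /choice[m hm] (x : S * A) : exists mu, Gamma I x.1 x.2 mu by exact: Gamma_ex.
  (* On paths starting elsewhere any admissible answer does; nonemptiness of [Gamma] supplies
     one. *)
  pose pi' (w : Defs.fpath S) a := if w.1 == s then pi w.2 a else m (fp_last w, a).
  have hpi' : nature I pi'.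
    move=> [s' u] a; rewrite /pi' /=; case: eqVneq => [->|_]; first exact: hp.
    exact: (hm (_, a)).
  have kK : stochastic (Kof (fun u => sigma (s, u)) pi).
    by apply: stochastic_Kof hp => u; exact: hs.
  pose P := path_probability s kK.
  have PE w : P (cyl w) =
      (if w.1 == s then (cell (Kof (fun u => sigma (s, u)) pi) w.2).2 else 0)%:E.
    exact: path_probability_cyl.
  have hP : is_Pr sigma pi' P.
    split=> [s'|[s' u] t]; first by rewrite PE.
    rewrite !PE /= /pi' /=; case: eqVneq => [->|_]; last by rewrite mul0e.
    by rewrite cell_rcons EFinM.
  have := h _ hpi' _ hP; rewrite (Pr_event nx G D kK)//.
    by have := PE (s, [::]); rewrite eqxx.
  by move=> u t; rewrite /Cyl !PE /= eqxx cell_rcons EFinM.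
exists (fun w => sg w.2); split=> [w|pi hpi P [P0 PS]]; first exact: hs.
have hp : natr I s (fun u => pi (s, u)) by move=> u a; exact: (hpi (s, u)).
rewrite (Pr_event nx G D (stochastic_Kof hs hp)); first exact: h.
  by rewrite /Cyl P0 eqxx.
by move=> u t; exact: (PS (s, u) t).
Qed.

Scheme sform_mut := Induction for sform Sort Prop
  with pform_mut := Induction for pform Sort Prop.

Variable Rl : rel S.
Hypothesis bisR : bisimulation L I Rl.

(** The induction statement for path formulas, dual to class invariance for state formulas in the
    mutual induction. *)
Definition clocked (psi : pform AP) := exists (Q : finType) (nx : Q -> Q)
  (G D : Q -> S -> bool) (q0 : Q),
  [/\ forall q, respects Rl (G q), forall q, respects Rl (D q) &
   forall om, psat L I psi om <-> exists i, G (iter i nx q0) (om i) /\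
     forall j, (j < i)%N -> D (iter j nx q0) (om j)].

Lemma respects_asbool (X : S -> Prop) : (forall s t, Rl s t -> X s <-> X t) ->
  respects Rl (fun s => `[< X s >]).
Proof. by move=> h s t /h; exact: asbool_equiv_eq. Qed.

Lemma clocked_next phi : (forall s t, Rl s t -> sat L I phi s <-> sat L I phi t) ->
  clocked (PNext phi).
Proof.
(* The clock is [false] at position 0 and [true] afterwards: the goal is off at position 0 and [D]
   blocks any passage beyond position 1. *)
move=> h; exists bool, (fun=> true), (fun q s => q && `[< sat L I phi s >]),
  (fun q _ => ~~ q), false; split=> [q s t st|//|om /=].
  by rewrite (respects_asbool h st).
split=> [/asboolP s1|[[|i] [//= /asboolP s1 Dj]]].
  by exists 1%N; split=> [//|[|j]].
case: i s1 Dj => [s1 _|i _ /(_ 1%N isT)]; [exact: s1|by []].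
Qed.

Lemma clocked_until phi1 phi2 :
  (forall s t, Rl s t -> sat L I phi1 s <-> sat L I phi1 t) ->
  (forall s t, Rl s t -> sat L I phi2 s <-> sat L I phi2 t) ->
  clocked (PUntil phi1 phi2).
Proof.
move=> h1 h2; exists unit, id, (fun _ s => `[< sat L I phi2 s >]),
  (fun _ s => `[< sat L I phi1 s >]), tt.
split=> [q|q|om /=]; [exact: respects_asbool|exact: respects_asbool|].
split=> [[k [i [_ [/asboolP g d]]]]|[i [/asboolP g d]]].
  by exists i; split=> // j /d/asboolP.
by exists i.+1, i; split=> //; split=> // j /d/asboolP.
Qed.

Lemma clocked_buntil phi1 phi2 k :
  (forall s t, Rl s t -> sat L I phi1 s <-> sat L I phi1 t) ->
  (forall s t, Rl s t -> sat L I phi2 s <-> sat L I phi2 t) ->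
  clocked (PBUntil phi1 phi2 k).
Proof.
(* The clock counts positions and saturates at [k], where the goal is off, so exactly the positions
   below [k] count. *)
move=> h1 h2; exists 'I_k.+1, (fun q : 'I_k.+1 => inord (minn q.+1 k)),
  (fun (q : 'I_k.+1) s => (q < k)%N && `[< sat L I phi2 s >]),
  (fun _ s => `[< sat L I phi1 s >]), ord0.
split=> [q s t st|q|om /=]; [|exact: respects_asbool|].
  by rewrite (respects_asbool h2 st).
have itE i : iter i (fun q : 'I_k.+1 => inord (minn q.+1 k)) ord0 = minn i k :> nat.
  elim: i => [|i IH] /=; first by rewrite min0n.
  rewrite inordK ?ltnS ?geq_minr// IH /minn.
  case: (ltnP i k) => ik; first by [].
  by rewrite ltnNge leqW//= ltnNge leqW.
split=> [[i [ik [/asboolP g d]]]|[i [/andP[+ /asboolP g] d]]].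
  exists i; split; last by move=> j /d/asboolP.
  by rewrite itE (minn_idPl (ltnW ik)) ik.
rewrite itE gtn_min ltnn orbF => ik; exists i; split=> //; split=> //.
by move=> j /d/asboolP.
Qed.

Lemma sat_inv phi s t : Rl s t -> sat L I phi s <-> sat L I phi t.
Proof.
have [Rrefl [Rsym [Rtrans bis]]] := bisR.
move: phi s t; apply: (@sform_mut AP (fun phi => forall s t, Rl s t ->
  sat L I phi s <-> sat L I phi t) clocked).
- by [].
- by move=> x s t /bis[/= ->].
- by move=> phi IH s t /IH h /=; rewrite h.
- by move=> phi1 IH1 phi2 IH2 s t st /=; rewrite (IH1 _ _ st) (IH2 _ _ st).
- move=> c p psi [Q [nx [G [D [q0 [GI DI psiE]]]]]] s t st.
  have [[a0]|nA] := pselect (inhabited A).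
    rewrite (sat_prob_wins c p s psiE) (sat_prob_wins c p t psiE).
    exact: (wins_inv a0 bisR Gamma_ex nx GI DI).
  (* Without actions there is no distribution on them, hence no scheduler, and both sides are
     false. *)
  have noS (sigma : Defs.fpath S -> A -> R) : ~ scheduler sigma.
    by move=> /(_ (s, [::]))/dist_ex_pos[a _]; exact/nA/inhabits.
  by split=> -[sigma [/noS]].
- exact: clocked_next.
- by move=> phi1 h1 phi2 h2; exact: clocked_until.
- by move=> phi1 h1 phi2 h2 k; exact: clocked_buntil.
Qed.

End Soundness.

Theorem theorem2 (R : realType) (S A AP : finType)
    (L : S -> {set AP}) (I : S -> A -> S -> interval R) :
  imdp_wf I ->
  forall s t : S, bisimilar L I s t ->
  forall phi : sform AP, wf_sform phi ->
    (sat L I phi s <-> sat L I phi t).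
Proof.
by move=> [_ Gamma_ex] s t [Rl [bisR st]] phi _; exact: (sat_inv Gamma_ex bisR).
Qed.
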